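(* Let $(M,g)$ be a compact connected Riemannian manifold with smooth boundary $\partial M$ (possibly empty), and let $p>1$. Then $$\frac{(p-1)^{p-1}}{2p^p}\,\Gamma_p^N(M)\;\le\;\mu_{1,p}(M)\;\le\;2^{p-1}\,\Gamma_p^N(M),$$ where $\mu_{1,p}(M)$ is the first nontrivial Neumann eigenvalue of the $p$-Laplacian on $M$ and $\Gamma_p^N(M)$ is the Neumann $p$-isocapacitary constant.
   Context: $\mathrm{d}V$ is the Riemannian volume measure on $M$ and $\mathrm{Vol}$ denotes the volume of measurable subsets of $M$ with respect to it. $C^\infty(M)$ denotes real-valued functions smooth on $M$ (up to the boundary). Capacity: for disjoint nonempty compact sets $A,B\subset M$, $$\mathrm{Cap}_p(A,B,M)=\inf\left\{\int_M|\nabla u|^p\,\mathrm{d}V:\ u\in C^\infty(M),\ u\ge 1\text{ on }A,\ u\le 0\text{ on }B\right\}.$$ By convention $\mathrm{Cap}_p(A,B,M)=+\infty$ if $A\cap B\neq\varnothing$, and $\mathrm{Cap}_p(A,B,M)=0$ if $A=\varnothing$ or $B=\varnothing$. Neumann $p$-isocapacitary constant: $$\Gamma_p^N(M)=\inf_{A,B\subset M}\frac{\mathrm{Cap}_p(A,B,M)}{\min\{\mathrm{Vol}(A),\mathrm{Vol}(B)\}},$$ the infimum being over all compact subsets $A,B$ of $M$ for which $\min\{\mathrm{Vol}(A),\mathrm{Vol}(B)\}>0$ (so that the quotient is meaningful). Neumann problem for the $p$-Laplacian: $-\Delta_p u=\mu|u|^{p-2}u$ in $M$, $\frac{\partial u}{\partial\nu}=0$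 on $\partial M$ ($\nu$ the outward unit normal); when $\partial M=\varnothing$ this is the $p$-Laplacian eigenvalue problem on a closed manifold. Its first nontrivial eigenvalue $\mu_{1,p}(M)$ is given by the Rayleigh quotient characterization $$\mu_{1,p}(M)=\inf_{\substack{u\in C^\infty(M)\\ u\not\equiv\mathrm{const}}}\frac{\int_M|\nabla u|^p\,\mathrm{d}V}{\min_{c\in\mathbb{R}}\int_M|u-c|^p\,\mathrm{d}V}.$$ *)

(* Defs.v *)
From HB Require Import structures.
From mathcomp Require Import all_boot all_order all_algebra.
From mathcomp Require Import all_classical all_reals all_analysis.

Set Implicit Arguments.
Unset Strict Implicit.
Unset Printing Implicit Defensive.
Import Order.TTheory GRing.Theory Num.Theory.
Import numFieldNormedType.Exports.
Local Open Scope classical_set_scope.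
Local Open Scope ring_scope.

Section SigmaFinitePack.
Context d (T : measurableType d) (R : realType).
Variable m : {measure set T -> \bar R}.
Hypothesis s : sigma_finite setT m.

Definition sigma_finite_pack & sigma_finite setT m : set T -> \bar R := m.

HB.instance Definition _ := Measure.on (sigma_finite_pack s).
HB.instance Definition _ :=
  Measure_isSigmaFinite.Build _ _ _ (sigma_finite_pack s) s.

End SigmaFinitePack.

Section LebesgueTuple.
Context {R : realType}.
Local Open Scope ereal_scope.
Notation RT := (measurableTypeR R).
Notation leb1 := (@lebesgue_measure R).

(* [lebesgue_tuple n] is the n-dimensional Lebesgue measure, on the product
   sigma-algebra of [n.-tuple R]: the (n+1)-dimensional one is the product of
   the one-dimensional and of the n-dimensional ones. *)
Fixpoint lebesgue_tuple (n : nat) : set (n.-tuple RT) -> \bar R :=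
  match n with
  | 0 => \d_[tuple]
  | m.+1 => fun A => \int[leb1]_x
      lebesgue_tuple [set v : m.-tuple RT | A [tuple of x :: v]]
  end.

Let cons2 n (xv : RT * n.-tuple RT) : n.+1.-tuple RT := [tuple of xv.1 :: xv.2].

Let measurable_cons2 n : measurable_fun setT (@cons2 n).
Proof. exact: measurable_cons. Qed.

Let uncons n (t : n.+1.-tuple RT) : RT * n.-tuple RT :=
  (tnth t ord0, [tuple of behead t]).

Let measurable_uncons n : measurable_fun setT (@uncons n).
Proof.
apply: measurable_fun_pair; first exact: measurable_tnth.
exact: measurable_behead.
Qed.

Let sigma_finite_packed d (T : measurableType d)
    (m : {measure set T -> \bar R}) : sigma_finite setT m ->
  exists m' : {sigma_finite_measure set T -> \bar R}, m = m' :> (set T -> _).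
Proof. by move=> s; exists (sigma_finite_pack s). Qed.

Let sigma_finite_prod d1 d2 (T1 : measurableType d1) (T2 : measurableType d2)
    (m1 : {sigma_finite_measure set T1 -> \bar R})
    (m2 : {sigma_finite_measure set T2 -> \bar R}) :
  sigma_finite setT (m1 \x m2).
Proof.
have /sigma_finiteP[F [TF ndF Foo]] := sigma_finiteT m1.
have /sigma_finiteP[G [TG ndG Goo]] := sigma_finiteT m2.
exists (fun n => F n `*` G n).
  rewrite -setXTT TF TG predeqE => -[x y]; split.
    move=> [/= [n _ Fnx] [k _ Gky]]; exists (maxn n k) => //; split.
    - by move: x Fnx; exact/subsetPset/ndF/leq_maxl.
    - by move: y Gky; exact/subsetPset/ndG/leq_maxr.
  by move=> [n _ []/= ? ?]; split; exists n.
move=> k; have [? ?] := Foo k; have [? ?] := Goo k.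
split; first exact: measurableX.
by rewrite product_measure1E// lte_mul_pinfty// ge0_fin_numE.
Qed.

Let lebesgue_tupleE n :
  exists m : {sigma_finite_measure set (n.-tuple RT) -> \bar R},
    @lebesgue_tuple n = m.
Proof.
elim: n => [|n [m mE]].
  apply: (@sigma_finite_packed _ _ (\d_[tuple])).
  exists (fun=> setT); first by rewrite bigcup_const.
  by move=> _; split => //=; rewrite diracE in_setT ltry.
pose pm : {measure set (n.+1.-tuple RT) -> \bar R} :=
  measure_function_pushforward__canonical__measure_function_Measure
    (leb1 \x m) (@measurable_cons2 n).
have pmE : @lebesgue_tuple n.+1 = pm.
  apply/funext => A; rewrite /= /pushforward /product_measure1.
  apply: eq_integral => x _; rewrite mE /=; congr (m _).
  by apply/seteqP; split => v; rewrite /xsection /= ?inE.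
rewrite pmE; apply: sigma_finite_packed.
have [F FT Foo] := sigma_finite_prod leb1 m.
exists (fun k => @uncons n @^-1` F k).
  by rewrite -preimage_bigcup -FT.
move=> k; have [mF Fk] := Foo k; split.
  by rewrite -[X in measurable X]setTI; exact: measurable_uncons.
rewrite /= /pushforward -comp_preimage (_ : _ \o _ = id) ?preimage_id//.
apply/funext => -[x v]; rewrite /uncons /cons2 /=; congr (_, _).
exact/val_inj.
Qed.

Let lebesgue_tuple0 n : @lebesgue_tuple n set0 = 0.
Proof. by have [m ->] := lebesgue_tupleE n; exact: measure0. Qed.

Let lebesgue_tuple_ge0 n A : 0 <= @lebesgue_tuple n A.
Proof. by have [m ->] := lebesgue_tupleE n; exact: measure_ge0. Qed.

Let lebesgue_tuple_sigma_additive n : semi_sigma_additive (@lebesgue_tuple n).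
Proof.
by have [m ->] := lebesgue_tupleE n; exact: measure_semi_sigma_additive.
Qed.

HB.instance Definition _ n := isMeasure.Build _ _ _ (@lebesgue_tuple n)
  (@lebesgue_tuple0 n) (@lebesgue_tuple_ge0 n)
  (@lebesgue_tuple_sigma_additive n).

Let lebesgue_tuple_sigma_finite n : sigma_finite setT (@lebesgue_tuple n).
Proof. by have [m ->] := lebesgue_tupleE n; exact: sigma_finiteT. Qed.

HB.instance Definition _ n := Measure_isSigmaFinite.Build _ _ _
  (@lebesgue_tuple n) (@lebesgue_tuple_sigma_finite n).

End LebesgueTuple.

Section SmoothHalfSpace.
Context {R : realType} {n : nat}.
Implicit Types (x : 'rV[R]_n) (S U : set 'rV[R]_n) (f : 'rV[R]_n -> R).

(* The first coordinate is nonnegative; for n = 0 this is the whole space. *)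
Definition halfspace : set 'rV[R]_n :=
  [set x | forall i : 'I_n, i = 0%N :> nat -> 0 <= x 0 i].

Definition basis_vec (i : 'I_n) : 'rV[R]_n := delta_mx 0 i.

(* Class C^k on U; meant for U open. *)
Fixpoint Ck (k : nat) U f : Prop :=
  match k with
  | 0 => forall x, U x -> {for x, continuous f}
  | l.+1 => (forall x, U x -> {for x, continuous f}) /\
      forall i, (forall x, U x -> derivable f x (basis_vec i)) /\
                Ck l U ('D_(basis_vec i) f)
  end.

(* Smoothness on an arbitrary set: f agrees near each point of S with a smooth
   function defined on an open set. This is smoothness up to the boundary when
   S is relatively open in the half-space. *)
Definition smooth_on S f : Prop :=
  forall x, S x -> exists U (g : 'rV[R]_n -> R),
    [/\ open U, U x, forall k, Ck k U g & forall y, S y -> U y -> f y = g y].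

(* Partial derivative within the half-space: the usual one at interior points,
   and one-sided in the first direction at boundary points, where the value of
   f outside the half-space must not matter. *)
Definition pderiv (i : 'I_n) f x : R :=
  lim ((fun h : R => h^-1 * (f (x + h *: basis_vec i) - f x)) @
       within [set h | halfspace (x + h *: basis_vec i)] (0 : R)^').

End SmoothHalfSpace.

Section Manifold.
Context {R : realType} {n : nat} {M : ptopologicalType}.

(* [cinv] is only relevant on the image of [cdom] by [cmap]. *)
Record chart := Chart {
  cdom : set M ;
  cmap : M -> 'rV[R]_n ;
  cinv : 'rV[R]_n -> M }.

Definition cimg (c : chart) : set 'rV[R]_n := cmap c @` cdom c.

Definition is_chart (c : chart) : Prop :=
  [/\ open (cdom c),
      exists2 U, open U & cimg c = U `&` halfspace,
      forall x, cdom c x -> cinv c (cmap c x) = x,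
      {within cdom c, continuous (cmap c)} &
      {within cimg c, continuous (cinv c)}].

(* The coordinate change from c to d. *)
Definition transition (c d : chart) (x : 'rV[R]_n) : 'rV[R]_n :=
  cmap d (cinv c x).

Definition overlap (c d : chart) : set 'rV[R]_n :=
  cmap c @` (cdom c `&` cdom d).

(* Smooth n-manifolds with (possibly empty) boundary on the space M. *)
Record smooth_manifold := SmoothManifold {
  atlas : set chart ;
  sm_hausdorff : hausdorff_space M ;
  sm_second_countable : @second_countable M ;
  atlas_chart : forall c, atlas c -> is_chart c ;
  atlas_cover : forall x : M, exists2 c, atlas c & cdom c x ;
  atlas_smooth : forall c d, atlas c -> atlas d ->
    forall j, smooth_on (overlap c d) (fun x => transition c d x 0 j) }.

Definition jacobian_within (tau : 'rV[R]_n -> 'rV[R]_n) (x : 'rV[R]_n) :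
    'M[R]_n :=
  \matrix_(i, j) pderiv i (fun y => tau y 0 j) x.

(* [gmat c x] is the matrix (g_ij) of the metric in the chart c at the point of
   coordinates x. Vectors are rows, hence the side of the transposed
   Jacobian. *)
Record riemannian_metric (X : smooth_manifold) := RiemannianMetric {
  gmat : chart -> 'rV[R]_n -> 'M[R]_n ;
  gmat_smooth : forall c, atlas X c ->
    forall i j, smooth_on (cimg c) (fun x => gmat c x i j) ;
  gmat_sym : forall c x, atlas X c -> cimg c x -> (gmat c x)^T = gmat c x ;
  gmat_pos : forall c x, atlas X c -> cimg c x ->
    forall v : 'rV[R]_n, v != 0 -> 0 < (v *m gmat c x *m v^T) 0 0 ;
  gmat_transition : forall c d x, atlas X c -> atlas X d -> overlap c d x ->
    let J := jacobian_within (transition c d) x in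
    gmat c x = J *m gmat d (transition c d x) *m J^T }.

Definition smooth_fun (X : smooth_manifold) (u : M -> R) : Prop :=
  forall c, atlas X c -> smooth_on (cimg c) (u \o cinv c).

Definition chart_at (X : smooth_manifold) (x : M) : chart :=
  s2val (cid2 (atlas_cover X x)).

(* The components of the gradient in the chart c: g^ij d_j u. *)
Definition grad (X : smooth_manifold) (g : riemannian_metric X) (c : chart)
    (u : M -> R) (x : M) : 'rV[R]_n :=
  (\row_j pderiv j (u \o cinv c) (cmap c x)) *m invmx (gmat g c (cmap c x)).

(* |grad u|, computed in a chosen chart around x; by [gmat_transition] the
   choice does not matter when u is smooth. *)
Definition grad_norm (X : smooth_manifold) (g : riemannian_metric X)
    (u : M -> R) (x : M) : R :=
  let c := chart_at X x in
  let v := grad g c u x in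
  Num.sqrt ((v *m gmat g c (cmap c x) *m v^T) 0 0).

Definition borel := g_sigma_algebraType (@open M).
HB.instance Definition _ := Measurable.on borel.

Definition row_of (t : n.-tuple (measurableTypeR R)) : 'rV[R]_n :=
  \row_i (tnth t i : R).

(* dV = sqrt(det g_ij) dx in every chart. As countably many charts cover M,
   this determines the Borel measure [vol]. *)
Definition is_riemannian_volume (X : smooth_manifold) (g : riemannian_metric X)
    (vol : {measure set borel -> \bar R}) : Prop :=
  forall c (A : set borel), atlas X c -> measurable A -> A `<=` cdom c ->
    vol A = (\int[@lebesgue_tuple R n]_(t in [set t | (cmap c @` A) (row_of t)])
               (Num.sqrt (\det (gmat g c (row_of t))))%:E)%E.

Section Constants.
Variables (X : smooth_manifold) (g : riemannian_metric X).
Variables (vol : {measure set borel -> \bar R}) (p : R).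
Local Open Scope ereal_scope.

Definition dirichlet_energy (u : M -> R) : \bar R :=
  \int[vol]_x ((grad_norm g u x) `^ p)%:E.

Definition capacity (A B : set M) : \bar R :=
  if `[< A `&` B !=set0 >] then +oo
  else if `[< A = set0 \/ B = set0 >] then 0
  else ereal_inf [set dirichlet_energy u | u in
         [set u : M -> R | [/\ smooth_fun X u,
            forall x, A x -> (1 <= u x)%R &
            forall x, B x -> (u x <= 0)%R]]].

(* The infimum of the empty set is +oo. *)
Definition neumann_isocapacitary : \bar R :=
  ereal_inf [set q | exists A B : set M,
    [/\ compact A, compact B, 0 < Order.min (vol A) (vol B) &
        q = capacity A B / Order.min (vol A) (vol B)]].

(* The first nontrivial Neumann eigenvalue of the p-Laplacian, through its
   Rayleigh quotient. The infimum over c is a minimum when M is compact. *)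
Definition neumann_eigenvalue : \bar R :=
  ereal_inf [set q | exists u : M -> R,
    [/\ smooth_fun X u, ~ (exists c, forall x, u x = c) &
        q = dirichlet_energy u /
            ereal_inf (range (fun c : R => \int[vol]_x (`|u x - c| `^ p)%:E))]].

End Constants.
End Manifold.

Arguments chart : clear implicits.
Arguments smooth_manifold : clear implicits.
Arguments borel : clear implicits.

(* Main.v *)
(* Upper bound: if u >= 1 on A and u <= 0 on B, convexity of s |-> s^p gives
   \int |u - c|^p >= 2^(1-p) min(Vol A, Vol B) for every c.

   Lower bound: let c be a median of u and v = +-(u - c). For a profile Phi that
   vanishes on s <= 0 and equals 1 on s >= 1, Phi(v/t) is a competitor for
   Cap({v >= t}, {v <= 0}), so Gamma Vol{v >= t} <= \int t^-p Phi'(v/t)^p |grad u|^p.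
   Multiplying by p t^(p-1) and integrating in t (Tonelli and layer cake) gives
   Gamma \int v_+^p <= K \int_{v > 0} |grad u|^p, where K = p \int_0^1 Phi'(r)^p dr/r.
   The minimal K is p^p/(p-1)^(p-1), reached by the non-smooth
   Phi(r) = r^(p/(p-1)); the factor 2 in the statement leaves room for a smooth
   approximation. Testing with functions of v only makes the coarea formula
   unnecessary. *)
Require Import Defs.
From HB Require Import structures.
From mathcomp Require Import all_boot all_order all_algebra.
From mathcomp Require Import all_classical all_reals all_analysis.
From mathcomp Require Import measurable_realfun.
From mathcomp Require Import ring lra.

Set Implicit Arguments.
Unset Strict Implicit.
Unset Printing Implicit Defensive.
Import Order.TTheory GRing.Theory Num.Theory.
Import numFieldNormedType.Exports.
Local Open Scope classical_set_scope.
Local Open Scope ring_scope.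

(** * Smooth functions of one real variable *)

(** The extremal profile minimises the integral of Phi'^p / r under total mass 1: the Euler-Lagrange
    equation makes Phi'^(p-1) proportional to r, so Phi' = q r^(q-1) with q = p/(p-1). A function h
    between 0 and a multiple of this derivative satisfies a pointwise bound p h^p <= K r h, so that
    only h has to be integrated, never h^p. Smoothing then amounts to cutting q r^(q-1) off near 0
    and 1 and renormalising the mass.

    The median makes Vol{v >= t} the smaller of the two volumes in the isocapacitary quotient. For
    the two signs of v the sets {v > 0} are disjoint, so the two energies add up without a further
    factor.

    Two obstacles shape the rest. |grad u| is computed in chosen charts, so integrals are compared
    as suprema over simple functions, and Tonelli is applied to a measurable substitute. The
    denominator of the Rayleigh quotient must be a positive real, which rests on the volume being
    positive on nonempty open sets and finite on M. *)

Section SmoothRealFunctions.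
Context {R : realType}.
Implicit Types (f g df : R -> R).

(** Derivatives enter as witnesses, so that membership is proved by naming a derivative formula,
    possibly one that stays inside a family such as [flat]. *)
Fixpoint class_C (k : nat) f : Prop :=
  match k with
  | 0 => continuous f
  | l.+1 => exists df, (forall x : R, is_derive x 1 f (df x)) /\ class_C l df
  end.

Lemma is_derive_continuous f (x a : R) : is_derive x 1 f a ->
  {for x, continuous f}.
Proof.
by move=> fa; apply/differentiable_continuous/derivable1_diffP; exact: ex_derive.
Qed.

Lemma class_CW k f : class_C k.+1 f -> class_C k f.
Proof.
elim: k f => [|k IH] f [df [fdf Cdf]].
  by move=> x; exact: is_derive_continuous.
by exists df; split => //; exact: IH.
Qed.

Lemma class_C_cst k (a : R) : class_C k (cst a).
Proof.
elim: k a => [|k IH] a /=; first by move=> x; exact: cvg_cst.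
exists (cst 0); split; last exact: IH.
by move=> x; exact: is_derive_cst.
Qed.

Lemma class_CD k f g : class_C k f -> class_C k g ->
  class_C k (fun x => f x + g x).
Proof.
elim: k f g => [|k IH] f g /=; first by move=> cf cg x; apply: cvgD; [exact: cf|exact: cg].
move=> [df [fdf Cdf]] [dg [gdg Cdg]].
exists (fun x => df x + dg x); split; last exact: IH.
by move=> x; exact: is_deriveD.
Qed.

Lemma class_CM k f g : class_C k f -> class_C k g ->
  class_C k (fun x => f x * g x).
Proof.
elim: k f g => [|k IH] f g; first by move=> cf cg x; apply: cvgM; [exact: cf|exact: cg].
move=> Cf Cg; have [Wf Wg] := (class_CW Cf, class_CW Cg).
have [df [fdf Cdf]] := Cf; have [dg [gdg Cdg]] := Cg.
exists (fun x => f x * dg x + g x * df x); split.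
  by move=> x; exact: is_deriveM.
by apply: class_CD; exact: IH.
Qed.

Lemma class_C_affine k f (a b : R) : class_C k f ->
  class_C k (fun x => f (a * x + b)).
Proof.
elim: k f => [|k IH] f.
  move=> cf x; apply: (@continuous_comp _ _ _ (fun y => a * y + b) f).
    by apply: cvgD; [apply: cvgM; [exact: cvg_cst|exact: cvg_id]|exact: cvg_cst].
  exact: cf.
move=> [df [fdf Cdf]].
exists (fun x => df (a * x + b) * cst a x); split; last first.
  by apply: class_CM; [exact: IH|exact: class_C_cst].
move=> x; apply: (@is_derive1_comp _ f (fun y => a * y + b)).
apply: is_derive_eq.
by rewrite addr0 -[LHS]/(a * 1) mulr1.
Qed.

(* For fixed e, this family is stable under derivation up to linear combinations. *)
Definition flat (e r x : R) : R :=
  if 0 < x then x `^ r * expR (- (e / x)) else 0.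

Lemma flat_ge0 (e r x : R) : 0 <= flat e r x.
Proof. by rewrite /flat; case: ifPn => // x0; rewrite mulr_ge0 ?powR_ge0 ?expR_ge0. Qed.

(** The exponential beats every power: [1 + y <= expR y] at [y = e / (m * x)], raised to the power
    [m], bounds the exponential factor by a multiple of x^m. The choice of [m] gives r + m >= 2, and
    x <= 1 turns x^(r+m) into at most x^2. The bound yields the derivative at 0. *)
Lemma flat_le_sqr (e r : R) : 0 < e ->
  exists C, forall x, x <= 1 -> flat e r x <= C * x ^+ 2.
Proof.
move=> e0; pose m := Num.max 1 (2 - r).
have m0 : 0 < m by rewrite /m lt_max ltr01.
have me0 : 0 < m / e by rewrite divr_gt0.
exists ((m / e) `^ m) => x x1; rewrite /flat; case: ifPn => x0; last first.
  by rewrite mulr_ge0 ?powR_ge0 ?sqr_ge0.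
have -> : - (e / x) = - (e / (m * x)) * m by field; rewrite !gt_eqF.
rewrite expRM.
have h : expR (- (e / (m * x))) `^ m <= (m / e) `^ m * x `^ m.
  rewrite -powRM ?(ltW x0) ?(ltW me0)//; apply: ge0_ler_powR; rewrite ?nnegrE.
  - exact: ltW.
  - exact: expR_ge0.
  - by rewrite mulr_ge0// ltW.
  - have z0 : 0 < e / (m * x) by rewrite divr_gt0// mulr_gt0.
    rewrite expRN (_ : m / e * x = (e / (m * x))^-1); last first.
      by field; rewrite !gt_eqF.
    rewrite lef_pV2 ?posrE ?expR_gt0//.
    by apply: le_trans (expR_ge1Dx _); rewrite lerDr.
apply: (le_trans (ler_wpM2l (powR_ge0 _ _) h)).
rewrite mulrCA ler_wpM2l ?powR_ge0// -powRD; last by rewrite (gt_eqF x0) implybT.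
rewrite -powR_mulrn ?(ltW x0)//; apply: ger_powR; first by rewrite x0.
by rewrite -lerBlDl /m le_max lexx orbT.
Qed.

Lemma le_sqr_is_derive0 f (C : R) : (forall x, `|x| <= 1 -> `|f x| <= C * x ^+ 2) ->
  is_derive (0 : R) (1 : R) f 0.
Proof.
move=> fC.
have f0 : f 0 = 0.
  apply/normr0_eq0/eqP; rewrite eq_le normr_ge0 andbT.
  by apply: (le_trans (fC 0 _)); rewrite ?normr0// expr0n mulr0.
have cvg0 : h^-1 *: ((f \o shift 0) (h *: 1) - f 0) @[h --> (0:R)^'] --> (0:R).
  apply/norm_cvg0P; apply: (@squeeze_cvgr _ _ _ _ (cst 0) (fun h => `|C| * `|h|)).
  - near=> h; rewrite normr_ge0 /= f0 subr0 addr0.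
    rewrite -[h *: 1]/(h * 1) mulr1 -[_ *: _]/(_ * _) normrM normfV.
    have h0 : h != 0 by near: h; exact: nbhs_dnbhs_neq.
    rewrite mulrC ler_pdivrMr ?normr_gt0//.
    rewrite -mulrA -expr2 real_normK ?num_real//.
    apply: (le_trans (fC h _)).
      near: h; apply: nbhs_dnbhs; apply/nbhs_ballP.
      by exists 1 => //= y; rewrite /ball /= sub0r normrN => /ltW.
    by rewrite ler_wpM2r ?sqr_ge0// ler_norm.
  - exact: cvg_cst.
  - rewrite -[X in _ --> X](mulr0 `|C|); apply: cvgM; first exact: cvg_cst.
    apply: cvg_within_filter; have := @norm_continuous _ R (0 : R).
    by rewrite /continuous_at normr0.
by apply: DeriveDef; [apply/cvg_ex; exists 0|exact/cvg_lim].
Unshelve. all: by end_near. Qed.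

Lemma flat_is_derive (e r x : R) : 0 < e ->
  is_derive x 1 (flat e r) (r * flat e (r - 1) x + e * flat e (r - 2) x).
Proof.
move=> e0; have [x0|x0|x0] := ltgtP x 0.
- rewrite /flat ltNge (ltW x0) /= !mulr0 addr0.
  apply: (@near_eq_is_derive _ _ _ (cst (0 : R))).
  near=> y; rewrite ltNge (@ltW _ _ y)//.
  by near: y; exact: lt_nbhsl.
- rewrite /flat x0.
  apply: (@near_eq_is_derive _ _ _ (fun y => y `^ r * expR (- (e * y^-1)))).
    near=> y; rewrite ifT//; near: y; exact: lt_nbhsr.
  have xN0 : x != 0 by rewrite gt_eqF.
  have d1 : is_derive x 1 (fun y : R => y^-1) (- x ^- 2).
    by apply: is_derive_eq; [exact: is_deriveV|rewrite /= -[_ *: _]/(_ * _) mulr1].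
  have d2 : is_derive x 1 (fun y : R => - (e * y^-1)) (e * x ^- 2).
    have := is_deriveN (is_deriveZ e d1).
    by move=> d2; apply: (is_derive_eq d2); rewrite -[_ *: _]/(_ * _) mulrN opprK.
  have d3 : is_derive x 1 (fun y : R => expR (- (e * y^-1)))
      (expR (- (e * x^-1)) * (e * x ^- 2)).
    exact: (@is_derive1_comp _ expR _ _ _ _ (is_derive_expR _) d2).
  apply: (is_derive_eq (is_deriveM (is_derive1_powR r x0) d3)).
  rewrite [x `^ (r - 2)]powRD ?xN0 ?implybT// powR_invn ?(ltW x0)//.
  by rewrite -![_ *: _]/(_ * _); ring.
- subst x; rewrite /flat ltxx !mulr0 addr0.
  have [C HC] := flat_le_sqr r e0.
  apply: (@le_sqr_is_derive0 _ C) => x x1.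
  rewrite ger0_norm; first by apply: HC; exact: le_trans (ler_norm _) _.
  exact: flat_ge0.
Unshelve. all: by end_near. Qed.

End SmoothRealFunctions.

(** * A nearly optimal profile *)

Section Profile.
Context {R : realType}.
Implicit Types (f g df : R -> R).
Notation mu := (@lebesgue_measure R).

Lemma class_C_flat k (e r : R) : 0 < e -> class_C k (flat e r).
Proof.
move=> e0; elim: k r => [|k IH] r.
  by move=> x; apply: is_derive_continuous; exact: flat_is_derive.
exists (fun x => r * flat e (r - 1) x + e * flat e (r - 2) x); split.
  by move=> x; exact: flat_is_derive.
by apply: class_CD; apply: class_CM; [exact: class_C_cst|exact: IH|exact: class_C_cst|exact: IH].
Qed.

Lemma powR_continuous_gt0 (q x : R) : 0 < x -> {for x, continuous (fun y => y `^ q)}.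
Proof. by move=> x0; apply: is_derive_continuous; exact: is_derive1_powR. Qed.

Lemma continuous_within_powR (q a : R) : 0 < q -> 0 < a ->
  {within `[0, a], continuous (fun x : R => x `^ q)}.
Proof.
move=> q0 a0; apply/continuous_within_itvP => //; split.
- by move=> x; rewrite in_itv /= => /andP[x0 _]; exact: powR_continuous_gt0.
- by rewrite powR0 ?gt_eqF//; exact: powR_cvg0.
- by apply: cvg_at_left_filter; exact: powR_continuous_gt0.
Qed.

(** For [1 < q] the integrand is continuous up to 0, so the fundamental theorem applies on the
    closed interval. The formula serves both for the mass of the limiting profile and for the layer
    cake identity. *)
Lemma integral_powR (q a : R) : 1 < q -> 0 < a ->
  (\int[mu]_(t in `[0%R, a]) (q * t `^ (q - 1))%:E = (a `^ q)%:E)%E.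
Proof.
move=> q1 a0; have q0 : 0 < q by rewrite (lt_trans _ q1).
have qB0 : 0 < q - 1 by rewrite subr_gt0.
rewrite (@continuous_FTC2 _ _ (fun x : R => x `^ q))//.
- by rewrite powR0 ?gt_eqF// sube0.
- have := continuous_within_powR qB0 a0.
  move=> h x; apply: cvgM; [exact: cvg_cst|exact: h].
- split.
  + by move=> x; rewrite in_itv /= => /andP[x0 _]; apply: ex_derive; exact: is_derive1_powR.
  + by rewrite powR0 ?gt_eqF//; exact: powR_cvg0.
  + by apply: cvg_at_left_filter; exact: powR_continuous_gt0.
- move=> x; rewrite in_itv /= => /andP[x0 _].
  by rewrite derive1E; apply: derive_val; exact: is_derive1_powR.
Qed.

(** The derivative of r^q, cut off by exp(-e/r) at 0 and by exp(-e/(1-r)) at 1; the exponent 0 in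
    the second factor leaves the bare exponential. Both cutoffs are at most 1, which preserves the
    pointwise bound of the extremal profile. *)
Definition profile (e q r : R) : R := q * (flat e (q - 1) r * flat e 0 (1 - r)).

Lemma class_C_profile k (e q : R) : 0 < e -> class_C k (profile e q).
Proof.
move=> e0; apply: class_CM; first exact: class_C_cst.
apply: class_CM; first exact: class_C_flat.
have -> : (fun x => flat e 0 (1 - x)) = (fun x => flat e 0 (-1 * x + 1)).
  by apply/funext => x; rewrite mulN1r addrC.
by apply: class_C_affine; exact: class_C_flat.
Qed.

Lemma profile_ge0 (e q r : R) : 0 <= q -> 0 <= profile e q r.
Proof. by move=> q0; rewrite !mulr_ge0 ?flat_ge0. Qed.

Lemma profile_out (e q r : R) : ~~ (0 < r < 1) -> profile e q r = 0.
Proof.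
rewrite negb_and /profile /flat => /orP[/negbTE ->|]; first by rewrite mul0r mulr0.
by rewrite subr_gt0 => /negbTE ->; rewrite !mulr0.
Qed.

Lemma profileE (e q r : R) : 0 < r < 1 ->
  profile e q r = q * r `^ (q - 1) * expR (- (e * (r^-1 + (1 - r)^-1))).
Proof.
move=> /andP[r0 r1]; rewrite /profile /flat r0 subr_gt0 r1 powRr0 mul1r.
by rewrite -mulrA -expRD -opprD -mulrDr mulrA.
Qed.

Lemma profile_le (e q r : R) : 0 <= q -> 0 <= e -> 0 < r ->
  profile e q r <= q * r `^ (q - 1).
Proof.
move=> q0 e0 r0; have [/andP[_ r1]|/profile_out ->] := boolP (0 < r < 1); last first.
  by rewrite mulr_ge0 ?powR_ge0.
rewrite profileE ?r0// ler_piMr ?mulr_ge0 ?powR_ge0//.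
rewrite expR_le1 oppr_le0 mulr_ge0// addr_ge0// invr_ge0 ltW//.
by rewrite subr_gt0.
Qed.

(** Along e = 1/(k+1) the profiles increase to q t^(q-1), whose mass on the unit interval is 1. By
    monotone convergence, integrals all bounded by [lam] would force 1 <= [lam]. *)
Lemma profile_integral_approx (q lam : R) : 1 < q -> lam < 1 ->
  exists2 e, 0 < e & (lam%:E < \int[mu]_(t in `]0%R, 1%R[) (profile e q t)%:E)%E.
Proof.
move=> q1 lam1; apply: contrapT => H.
have q0 : 0 < q by rewrite (lt_trans _ q1).
pose f (k : nat) (t : measurableTypeR R) : \bar R := (profile k.+1%:R^-1 q t)%:E.
have e0 (k : nat) : 0 < (k.+1%:R : R)^-1 by rewrite invr_gt0.
pose D : set (measurableTypeR R) := [set` `]0%R, 1%R[].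
have mf k : measurable_fun D (f k).
  apply/measurable_EFinP; apply: measurable_funTS; apply: continuous_measurable_fun.
  exact: (class_C_profile 0 q (e0 k)).
have f0 k t : D t -> (0 <= f k t)%E.
  by move=> _; rewrite lee_fin profile_ge0 ?ltW.
have fnd t : D t -> {homo f^~ t : n m / (n <= m)%N >-> (n <= m)%E}.
  rewrite /D /= in_itv /= => t01 n m nm; rewrite lee_fin !profileE//.
  have /andP[t0 t1] := t01.
  rewrite ler_wpM2l ?mulr_ge0 ?powR_ge0 ?(ltW q0)// ler_expR lerN2 ler_wpM2r//.
    by rewrite addr_ge0// invr_ge0 ltW// subr_gt0.
  by rewrite lef_pV2 ?posrE// ler_nat.
have mD : measurable D by exact: measurable_itv.
have := @cvg_monotone_convergence _ _ _ mu D mD f mf f0 fnd.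
have -> : (\int[mu]_(x in D) limn (f ^~ x) = 1)%E.
  have -> : 1%E = ((1 : R) `^ q)%:E :> \bar R by rewrite powR1.
  rewrite -(integral_powR q1 ltr01).
  have mw (D' : set (measurableTypeR R)) : measurable_fun D' (fun t => (q * t `^ (q - 1))%:E).
    apply/measurable_EFinP; apply: measurable_funTS.
    by apply: measurable_funM => //; exact: measurable_powR.
  transitivity (\int[mu]_(t in `]0%R, 1%R[) (q * t `^ (q - 1))%:E)%E; last first.
    by rewrite integral_itv_bndo_bndc ?integral_itv_obnd_cbnd//; exact: mw.
  apply: eq_integral => t; rewrite inE /D /= in_itv /= => t01.
  apply/cvg_lim => //; apply: cvg_EFin; first exact: nearW.
  rewrite (_ : fine \o _ = fun k => q * t `^ (q - 1) *
      expR (- (k.+1%:R^-1 * (t^-1 + (1 - t)^-1)))); last first.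
    by apply/funext => k; rewrite /= profileE.
  rewrite -[X in _ --> X]mulr1; apply: cvgM; first exact: cvg_cst.
  have g0 : - ((k.+1%:R : R)^-1 * (t^-1 + (1 - t)^-1)) @[k --> \oo] --> (0 : R).
    rewrite -[X in _ --> X]oppr0; apply: cvgN.
    rewrite -[X in _ --> X](mul0r (t^-1 + (1 - t)^-1)).
    by apply: cvgM; [exact: cvg_harmonic|exact: cvg_cst].
  have := continuous_cvg _ (@continuous_expR R 0) g0.
  by rewrite expR0; apply; exact: _.
move=> fcvg.
suff : (1 <= lam%:E :> \bar R)%E by rewrite lee_fin leNgt lam1.
rewrite -(cvg_lim _ fcvg)//; apply: lime_le; first by apply/cvg_ex; exists 1%E.
apply: nearW => k; rewrite leNgt; apply/negP => lamf.
by apply: H; exists k.+1%:R^-1.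
Qed.


Lemma continuous_supported_integrable f (a b : R) (D : set (measurableTypeR R)) :
  continuous f -> (forall x, ~~ (a <= x <= b) -> f x = 0) -> measurable D ->
  mu.-integrable D (EFin \o f).
Proof.
move=> cf f0 mD; apply: (@integrableS _ _ _ _ setT) => //.
have fab : mu.-integrable `[a, b] (EFin \o f).
  apply: continuous_compact_integrable; first exact: segment_compact.
  exact: continuous_subspaceT.
have := (@integrable_mkcond _ _ _ mu _ (EFin \o f) (measurable_itv `[a, b])).1 fab.
apply: eq_integrable => // x _; rewrite /patch; case: ifPn => //.
by rewrite notin_setE /= in_itv /= => /negP /f0 ->.
Qed.

(** Integrating from -oo rather than from [a] makes the fundamental theorem available at every real
    point, including [a] and the points to its left. *)
Lemma antiderivative (f : R -> R) (a b : R) :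
  continuous f -> (forall x, ~~ (a < x < b) -> f x = 0) -> a < b ->
  exists F : R -> R, [/\ (forall x : R, is_derive x 1 F (f x)),
    (forall x, x <= a -> F x = 0) &
    (forall x, b <= x -> F x = \int[mu]_(t in `]a, b[) f t)].
Proof.
move=> cf f0 ab; exists (fun x => \int[mu]_(t in [set` Interval -oo%O (BRight x)]) f t); split.
- move=> x.
  have fi : mu.-integrable [set` Interval -oo%O (BRight (x + 1))] (EFin \o f).
    apply: (@continuous_supported_integrable _ a b) => // y.
    by move=> yab; apply: f0; apply: contra yab => /andP[/ltW -> /ltW ->].
  have xx1 : x < x + 1 by rewrite ltrDl.
  have := continuous_FTC1 xx1 fi.
  move=> /= /(_ (ltNyr x) (cf x)) [dF F'].
  by apply: DeriveDef; [exact: dF|rewrite -derive1E; exact: F'].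
- move=> x xa; rewrite (@eq_Rintegral _ _ _ _ _ (cst 0)).
    by rewrite /Rintegral integral0.
  move=> t; rewrite inE /= in_itv /= => tx.
  by apply: f0; rewrite ltNge (le_trans tx xa).
- move=> x bx; rewrite Rintegral_mkcond [RHS]Rintegral_mkcond.
  congr (Rintegral _ _ _); apply/funext => t; rewrite /patch.
  case: ifPn; case: ifPn => //; rewrite ?inE ?notin_setE /= !in_itv /=.
    by move=> /negP tab _; rewrite f0.
  by move=> /andP[_ tb]; rewrite (le_trans (ltW tb) bx).
Qed.

(** The last clause is the pointwise form of optimality. From f <= q x^(q-1) and (q-1)(p-1) = 1
    follows f^(p-1) <= q^(p-1) x, and p q^(p-1) = p^p/(p-1)^(p-1) is the optimal constant. Dividing
    f by its mass N costs the factor N^(1-p), which is kept below 2. *)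
Lemma smooth_step (p : R) : 1 < p -> exists h Phi : R -> R,
  [/\ (forall k, class_C k h), (forall x : R, is_derive x 1 Phi (h x)),
     (forall x, 0 <= h x), (forall x, ~~ (0 < x < 1) -> h x = 0) &
  [/\ (forall x, x <= 0 -> Phi x = 0), (forall x, 1 <= x -> Phi x = 1) &
      forall x, 0 < x -> p * h x `^ p <=
        2 * p `^ p / (p - 1) `^ (p - 1) * (x * h x) ]].
Proof.
move=> p1; pose q := p / (p - 1).
have pB0 : 0 < p - 1 by rewrite subr_gt0.
have p0 : 0 < p by rewrite (lt_trans _ p1).
have q1 : 1 < q by rewrite /q ltr_pdivlMr// mul1r ltrBlDr ltrDl.
have q0 : 0 < q by rewrite (lt_trans _ q1).
(* Chosen so that lam^(p-1) = 1/2: a mass above [lam] makes the normalisation cost at most the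
   factor 2 of the statement. *)
pose lam : R := 2^-1 `^ (p - 1)^-1.
have lam0 : 0 < lam by rewrite powR_gt0// invr_gt0.
have lam1 : lam < 1.
  have <- : 1 `^ (p - 1)^-1 = 1 :> R by rewrite powR1.
  apply: gt0_ltr_powR.
  - by rewrite invr_gt0.
  - by rewrite nnegrE invr_ge0.
  - by rewrite nnegrE.
  - by rewrite invf_lt1 ?ltr1n.
have [e e0 eN] := profile_integral_approx q1 lam1.
pose f := profile e q.
have cf : continuous f := class_C_profile 0 q e0.
have f0 x : ~~ (0 < x < 1) -> f x = 0 by exact: profile_out.
have [F [dF F0 F1]] := antiderivative cf f0 ltr01.
set N := \int[mu]_(t in _) _ in F1.
have lamN : lam < N.
  rewrite -lte_fin (lt_le_trans eN)//.
  rewrite /N /Rintegral fineK//; apply: integrable_fin_num => //.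
  apply: (@continuous_supported_integrable _ 0 1) => // y.
  by move=> yab; apply: f0; apply: contra yab => /andP[/ltW -> /ltW ->].
have N0 : 0 < N := lt_trans lam0 lamN.
have dPhi (x : R) : is_derive x 1 (fun y => N^-1 * F y) (N^-1 * f x).
  exact: (is_deriveZ N^-1 (dF x)).
exists (fun x => N^-1 * f x), (fun x => N^-1 * F x); split => //.
- by move=> k; apply: class_CM; [exact: class_C_cst|exact: class_C_profile].
- by move=> x; rewrite mulr_ge0 ?invr_ge0 ?profile_ge0 ?ltW.
- by move=> x /f0 ->; rewrite mulr0.
- split.
  + by move=> x /F0 ->; rewrite mulr0.
  + by move=> x /F1 ->; rewrite mulVf// gt_eqF.
  + move=> x x0.
    have fx0 : 0 <= f x by rewrite profile_ge0 ?ltW.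
    have fp : f x `^ p <= q `^ (p - 1) * x * f x.
      rewrite -(mulr_powRB1 fx0 p0) mulrC ler_wpM2r//.
      have -> : q `^ (p - 1) * x = (q * x `^ (q - 1)) `^ (p - 1).
        rewrite powRM ?powR_ge0 ?(ltW q0)// -powRrM.
        have -> : (q - 1) * (p - 1) = 1 by rewrite /q; field; rewrite gt_eqF.
        by rewrite powRr1 ?(ltW x0).
      apply: ge0_ler_powR; rewrite ?nnegrE ?(ltW pB0)//.
        by rewrite mulr_ge0 ?powR_ge0 ?(ltW q0).
      by apply: profile_le; rewrite ?(ltW q0) ?(ltW e0).
    have Np : N^-1 `^ (p - 1) <= 2.
      rewrite -powR_inv1 ?(ltW N0)// powRAC powR_inv1 ?powR_ge0//.
      rewrite -[leRHS]invrK lef_pV2 ?posrE ?invr_gt0 ?powR_gt0//.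
      have -> : 2^-1 = lam `^ (p - 1).
        by rewrite /lam -powRrM mulVf ?gt_eqF// powRr1.
      by apply: ge0_ler_powR; rewrite ?nnegrE ?ltW.
    have qE : p * q `^ (p - 1) = p `^ p / (p - 1) `^ (p - 1).
      rewrite /q powRM ?invr_ge0 ?(ltW p0) ?(ltW pB0)//.
      rewrite mulrA mulr_powRB1 ?(ltW p0)//; congr (_ * _).
      by rewrite -powR_inv1 ?(ltW pB0)// powRAC powR_inv1 ?powR_ge0.
    rewrite powRM ?invr_ge0 ?(ltW N0)// -(mulr_powRB1 _ p0) ?invr_ge0 ?(ltW N0)//.
    rewrite -[2 * _ / _]mulrA -qE.
    set A := N^-1 in Np *; set B := A `^ (p - 1) in Np *.
    have A0 : 0 <= A by rewrite invr_ge0 ltW.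
    set Q := q `^ (p - 1) in fp *.
    apply: (@le_trans _ _ (p * (A * B * (Q * x * f x)))).
      by rewrite ler_wpM2l ?(ltW p0)// ler_wpM2l ?mulr_ge0 ?powR_ge0.
    rewrite (_ : p * _ = B * (p * Q * (x * (A * f x)))); last by ring.
    rewrite -[leRHS]mulrA ler_wpM2r//.
    have Q0 : 0 <= Q by exact: powR_ge0.
    by apply: mulr_ge0; apply: mulr_ge0; rewrite ?(ltW p0) ?(ltW x0)// mulr_ge0.
Qed.

End Profile.

(** * Composition with smooth functions *)

Section ChainRule.
Context {R : realType} {n : nat}.
Local Notation V := 'rV[R]_n.
Implicit Types (U S : set V) (f g : V -> R).

(** A directional derivative is a derivative along a line, which reduces the chain rule for an outer
    function of one variable to the one-dimensional one. *)
Lemma is_derive_line f (x v : V) (df : R) :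
  is_derive x v f df <-> is_derive (0 : R) (1 : R) (fun h : R => f (h *: v + x)) df.
Proof.
have E : (fun h : R => h^-1 *: (((fun h : R => f (h *: v + x)) \o shift 0) (h *: 1) -
    f (0 *: v + x))) = (fun h : R => h^-1 *: ((f \o shift x) (h *: v) - f x)).
  by apply/funext => h; rewrite /= addr0 -[h *: 1]/(h * 1) mulr1 scale0r add0r.
split=> -[fD fE]; apply: DeriveDef.
- by rewrite /derivable E.
- by rewrite /derive E.
- by move: fD; rewrite /derivable E.
- by move: fE; rewrite /derive E.
Qed.

Lemma is_derive_comp (psi : R -> R) f (x v : V) (a df : R) :
  is_derive x v f df -> is_derive (f x) (1 : R) psi a ->
  is_derive x v (psi \o f) (a * df).
Proof.
move=> /is_derive_line fd psid; apply/is_derive_line.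
apply: (@is_derive1_comp _ psi (fun h : R => f (h *: v + x))) => //.
by rewrite scale0r add0r.
Qed.

Lemma open_near U (x : V) : open U -> U x -> \forall y \near x, U y.
Proof. by move=> oU Ux; exact: open_nbhs_nbhs. Qed.

Lemma continuous_for_eq f g U (x : V) :
  open U -> U x -> (forall y, U y -> f y = g y) ->
  {for x, continuous f} -> {for x, continuous g}.
Proof.
move=> oU Ux fg cf; change (g @ x --> g x); rewrite -(fg _ Ux).
have fgn : \forall y \near x, f y = g y.
  by near=> y; apply: fg; near: y; exact: open_near.
exact: (cvg_trans (near_eq_cvg fgn) cf).
Unshelve. all: by end_near. Qed.

Lemma Ck_eq k U f g : open U -> (forall x, U x -> f x = g x) ->
  Ck k U f -> Ck k U g.
Proof.
move=> oU; elim: k f g => [|k IH] f g fg.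
  by move=> cf x Ux; exact: (continuous_for_eq oU Ux fg (cf x Ux)).
move=> [cf df]; split.
  by move=> x Ux; exact: (continuous_for_eq oU Ux fg (cf x Ux)).
have fg_near x : U x -> \forall y \near x, f y = g y.
  by move=> Ux; near=> y; apply: fg; near: y; exact: open_near.
move=> i; have [dfi Cfi] := df i; split.
  move=> x Ux; apply: near_eq_derivable (dfi x Ux); exact: fg_near.
apply: IH Cfi => x Ux; apply: near_eq_derive; exact: fg_near.
Unshelve. all: by end_near. Qed.

Lemma CkW k U f : Ck k.+1 U f -> Ck k U f.
Proof.
elim: k f => [|k IH] f; first by case.
move=> [cf df]; split => // i; have [dfi Cfi] := df i.
by split => //; exact: IH.
Qed.

Lemma CkM k U f g : open U -> Ck k U f -> Ck k U g -> Ck k U (f * g).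
Proof.
move=> oU.
have CkD j u v : Ck j U u -> Ck j U v -> Ck j U (u + v).
  elim: j u v => [|j IH] u v.
    by move=> cu cv x Ux; exact: continuousD (cu x Ux) (cv x Ux).
  move=> [cu du] [cv dv]; split.
    by move=> x Ux; exact: continuousD (cu x Ux) (cv x Ux).
  move=> i; have [dui Cui] := du i; have [dvi Cvi] := dv i; split.
    by move=> x Ux; apply: derivableD; [exact: dui|exact: dvi].
  apply: (Ck_eq oU _ (IH _ _ Cui Cvi)) => x Ux.
  by rewrite deriveD; [|exact: dui|exact: dvi].
elim: k f g => [|k IH] f g.
  by move=> cf cg x Ux; exact: continuousM (cf x Ux) (cg x Ux).
move=> Cf Cg; have [cf df] := Cf; have [cg dg] := Cg; split.
  by move=> x Ux; exact: continuousM (cf x Ux) (cg x Ux).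
move=> i; have [dfi Cfi] := df i; have [dgi Cgi] := dg i; split.
  by move=> x Ux; apply: derivableM; [exact: dfi|exact: dgi].
apply: (Ck_eq oU _ (CkD _ _ _ (IH _ _ (CkW Cf) Cgi) (IH _ _ (CkW Cg) Cfi))) => x Ux.
by rewrite deriveM; [|exact: dfi|exact: dgi].
Qed.

Lemma Ck_comp k U (psi : R -> R) f : open U -> class_C k psi -> Ck k U f ->
  Ck k U (psi \o f).
Proof.
move=> oU; elim: k psi f => [|k IH] psi f.
  by move=> cpsi cf x Ux; apply: continuous_comp; [exact: cf|exact: cpsi].
move=> [dpsi [psid Cdpsi]] Cf; have [cf df] := Cf; split.
  move=> x Ux; apply: continuous_comp; first exact: cf.
  exact: is_derive_continuous (psid _).
move=> i; have [dfi Cfi] := df i.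
have D x : U x -> is_derive x (basis_vec i) (psi \o f)
    (dpsi (f x) * 'D_(basis_vec i) f x).
  by move=> Ux; apply: is_derive_comp => //; apply/derivableP/dfi.
split; first by move=> x /D/@ex_derive.
apply: (Ck_eq oU _ (CkM oU (IH _ _ Cdpsi (CkW Cf)) Cfi)) => x /D/@derive_val ->.
by [].
Qed.

Lemma smooth_on_comp S (psi : R -> R) f : (forall k, class_C k psi) ->
  smooth_on S f -> smooth_on S (psi \o f).
Proof.
move=> Cpsi sf x Sx; have [U [g [oU Ux Cg fg]]] := sf x Sx.
exists U, (psi \o g); split => // [k|y Sy Uy]; first exact: Ck_comp.
by rewrite /= fg.
Qed.

(** As [S] is relatively open in the half-space, the points tested by [pderiv] near [x] lie in [S],
    where [f] agrees with its extension [g]. The one-sided limit is thus a restriction of the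
    two-sided limit that defines the derivative of [g]. *)
Lemma pderivE S U f g (x : V) i : open U -> U x ->
  (exists2 W, open W & S = W `&` halfspace) -> S x ->
  (forall y, S y -> U y -> f y = g y) ->
  derivable g x (basis_vec i) ->
  pderiv i f x = 'D_(basis_vec i) g x.
Proof.
move=> oU Ux [W oW SE] Sx fg dg.
have [Wx Hx] : W x /\ halfspace x by move: Sx; rewrite SE.
set A := [set h : R | halfspace (x + h *: basis_vec i)].
(* Positive increments never leave the half-space, so even at a boundary point the filter is proper
   and its limit is unique. *)
have PA : ProperFilter (within A (0 : R)^').
  apply: Build_ProperFilter_ex => P /nbhs_ballP[e /= e0 eP].
  exists (e / 2); have e20 : 0 < e / 2 by rewrite divr_gt0.
  apply: (eP (e / 2)); rewrite ?gt_eqF//.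
    by rewrite /ball /= sub0r normrN gtr0_norm// ltr_pdivrMr// ltr_pMr// ltr1n.
  move=> j j0; rewrite !mxE addr_ge0 ?Hx//.
  by rewrite mulr_ge0 ?ler0n ?(ltW e20).
rewrite /pderiv; apply/cvg_lim; first exact: Rhausdorff.
have : h^-1 *: ((g \o shift x) (h *: basis_vec i) - g x) @[h --> within A (0 : R)^']
    --> 'D_(basis_vec i) g x by apply: cvg_within_filter; exact: dg.
apply: cvg_trans; apply: near_eq_cvg; rewrite near_withinE.
have lx : (fun h : R => x + h *: basis_vec i) @ (0 : R)^' --> x + 0 *: basis_vec i.
  apply: cvg_within_filter; apply: cvgD; first exact: cvg_cst.
  by apply: cvgZl; exact: cvg_id.
rewrite scale0r addr0 in lx.
near=> h => Ah; rewrite /= [h *: _ + x]addrC -!fg//.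
  rewrite SE; split=> //; near: h; apply: lx; exact: open_near.
by near: h; apply: lx; exact: open_near.
Unshelve. all: by end_near. Qed.

Lemma pderiv_comp S (psi dpsi : R -> R) f (x : V) i :
  (forall y : R, is_derive y 1 psi (dpsi y)) ->
  (exists2 W, open W & S = W `&` halfspace) -> S x -> smooth_on S f ->
  pderiv i (psi \o f) x = dpsi (f x) * pderiv i f x.
Proof.
move=> dpsiP Sh Sx sf; have [U [g [oU Ux Cg fg]]] := sf x Sx.
have [_ dg] := Cg 1; have [dgi _] := dg i.
have gD : is_derive x (basis_vec i) g ('D_(basis_vec i) g x).
  by apply/derivableP/dgi.
have pgD := is_derive_comp gD (dpsiP (g x)).
rewrite (pderivE oU Ux Sh Sx fg (dgi x Ux)).
rewrite (@pderivE S U (psi \o f) (psi \o g) x i oU Ux Sh Sx); last exact: ex_derive.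
  by rewrite derive_val fg.
by move=> y Sy Uy; rewrite /= fg.
Qed.

End ChainRule.

(** * Determinants and boxes *)

Section MonotoneLowerIntegral.
Context d (T : measurableType d) (R : realType) (mu : {measure set T -> \bar R}).
Local Open Scope ereal_scope.
Import HBNNSimple.

(* The integral of a nonnegative function is a supremum over simple functions
   below it, so monotonicity does not need measurability. *)
Lemma ge0_le_integralT (f g : T -> \bar R) : (forall x, 0 <= f x) ->
  (forall x, f x <= g x) -> \int[mu]_x f x <= \int[mu]_x g x.
Proof.
move=> f0 fg; have g0 x : 0 <= g x by exact: le_trans (f0 x) (fg x).
rewrite !ge0_integralTE//; apply: le_ereal_sup => _ [h hf <-].
by exists h => // x; exact: le_trans (hf x) (fg x).
Qed.

End MonotoneLowerIntegral.

Section PositiveDefinite.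
Context {R : realType}.

Lemma cvg_det (T : Type) (F : set_system T) (FF : Filter F) n
    (A : T -> 'M[R]_n) (B : 'M[R]_n) :
  (forall i j, A x i j @[x --> F] --> B i j) -> \det (A x) @[x --> F] --> \det B.
Proof.
move=> AB; apply: cvg_big => [|s _]; first exact: add_continuous.
apply: cvgM; first exact: cvg_cst.
by apply: cvg_big => [|i _]; [exact: mul_continuous|exact: AB].
Qed.

(** The segment from the identity to [A] consists of positive definite, hence invertible, matrices.
    The determinant is continuous along it and starts at 1, so a nonpositive value at [A] would
    create a zero by the intermediate value theorem. *)
Lemma posdef_det_gt0 n (A : 'M[R]_n) :
  (forall v : 'rV[R]_n, v != 0 -> 0 < (v *m A *m v^T) 0 0) -> 0 < \det A.
Proof.
move=> Apos; pose B (t : R) : 'M[R]_n := (1 - t)%:M + t *: A.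
have B_neq0 t : 0 <= t <= 1 -> \det (B t) != 0.
  move=> /andP[t0 t1]; apply/negP => /det0P[v v0 vB].
  have : (v *m B t *m v^T) 0 0 = 0 by rewrite vB mul0mx mxE.
  rewrite mulmxDr mul_mx_scalar -scalemxAr mulmxDl -!scalemxAl !mxE => E.
  have vA := Apos v v0; rewrite mxE in vA.
  have vv : 0 < \sum_j v 0 j * v^T j 0.
    have : exists j, v 0 j != 0.
      apply: contrapT => H; move/eqP: v0; apply; apply/rowP => j.
      by rewrite mxE; apply: contrapT => /eqP vj; apply: H; exists j.
    move=> [j vj]; rewrite (bigD1 j)//= ltr_pwDl//.
      by rewrite mxE -expr2 exprn_even_gt0.
    by apply: sumr_ge0 => i _; rewrite mxE -expr2 sqr_ge0.
  move: E; have [->|t_neq0] := eqVneq t 0.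
    by rewrite mul0r addr0 subr0 mul1r => E; rewrite E ltxx in vv.
  have tgt0 : 0 < t by rewrite lt_neqAle eq_sym t_neq0.
  apply/eqP; rewrite gt_eqF// ltr_wpDl ?mulr_gt0//.
  by rewrite mulr_ge0 ?subr_ge0// ltW.
rewrite ltNge; apply/negP => detA.
have Bc : continuous (fun t => \det (B t)).
  move=> t; apply: cvg_det => i j; rewrite !mxE.
  have -> : (fun x => B x i j) = fun x => (1 - x) *+ (i == j) + x * A i j.
    by apply/funext => x; rewrite !mxE.
  apply: cvgD; last by apply: cvgM; [exact: cvg_id|exact: cvg_cst].
  by apply: cvgMn; apply: cvgB; [exact: cvg_cst|exact: cvg_id].
have B0 : \det (B 0) = 1 by rewrite /B subr0 scale0r addr0 det1.
have B1 : \det (B 1) = \det A by rewrite /B subrr scale1r raddf0 add0r.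
have [|t] := @IVT R (fun t => \det (B t)) 0 1 0 ler01 (continuous_subspaceT Bc).
  by rewrite B0 B1 ge_min le_max ler01 detA orbT.
by rewrite in_itv /= => /B_neq0/eqP.
Qed.

End PositiveDefinite.

Section LebesgueBox.
Context {R : realType}.
Local Open Scope ereal_scope.
Notation RT := (measurableTypeR R).

Definition box n (a b : 'I_n -> R) : set (n.-tuple RT) :=
  [set t | forall i, (a i < tnth t i < b i)%R].

Lemma measurable_box n (a b : 'I_n -> R) : measurable (box a b).
Proof.
have -> : box a b = \bigcap_(i in [set: 'I_n])
    ((fun t : n.-tuple RT => tnth t i) @^-1` `]a i, b i[).
  apply/seteqP; split => t /= tab i; first by move=> _; rewrite /= in_itv /=.
  by have := tab i I; rewrite /= in_itv.
apply: fin_bigcap_measurable => [|i _]; first exact: finite_finset.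
rewrite -[X in measurable X]setTI; exact: measurable_tnth.
Qed.

(** Induction along the recursive definition of the measure: the slice at x is the box of the
    remaining coordinates if x lies in the first interval, and empty otherwise. *)
Lemma lebesgue_tuple_box n (a b : 'I_n -> R) : (forall i, (a i <= b i)%R) ->
  lebesgue_tuple (box a b) = (\prod_(i < n) (b i - a i))%:E.
Proof.
elim: n a b => [|n IH] a b ab.
  rewrite big_ord0 /= diracE mem_set//.
  by move=> [].
rewrite big_ord_recl /=.
transitivity (\int[@lebesgue_measure R]_x
    ((\prod_(i < n) (b (lift ord0 i) - a (lift ord0 i)))%:E *
     (\1_(`]a ord0, b ord0[%classic) x)%:E)).
  apply: eq_integral => x _.
  rewrite -IH; last by move=> i; exact: ab.
  rewrite indicE; have [x0|x0] := boolP (x \in _).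
    rewrite mule1; congr (lebesgue_tuple _); apply/seteqP; split => v /= vab i.
      by have := vab (lift ord0 i); rewrite tnthS.
    case: (unliftP ord0 i) => [j|] ->; rewrite ?tnthS ?tnth0//.
    by move: x0; rewrite inE /= in_itv.
  rewrite mule0 [X in lebesgue_tuple X](_ : _ = set0) ?measure0//.
  apply/seteqP; split => v //= vab; move/negP: x0; apply.
  by rewrite inE /= in_itv; have := vab ord0; rewrite tnth0.
rewrite ge0_integralZl//; last first.
- by rewrite lee_fin prodr_ge0// => i _; rewrite subr_ge0.
- exact/measurable_EFinP.
rewrite integral_indic// setIT.
rewrite [X in _ * X](lebesgue_measure_itv `]a ord0, b ord0[).
rewrite /= lte_fin EFinM muleC; congr (_ * _); case: ifPn => //.
rewrite -leNgt => ba; rewrite (_ : b ord0 = a ord0) ?subrr//.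
by apply/eqP; rewrite eq_le ba ab.
Qed.

End LebesgueBox.

(** * Charts and Riemannian volume *)

Section ManifoldTopology.
Context {R : realType} {n : nat} {M : ptopologicalType}.
Variables (X : smooth_manifold R n M) (g : riemannian_metric X).
Implicit Types (c : chart R n M).

Lemma smooth_on_cvg S (f : 'rV[R]_n -> R) x : smooth_on S f -> S x ->
  f y @[y --> within S (nbhs x)] --> f x.
Proof.
move=> sf Sx; have [U [h [oU Ux Ch fh]]] := sf x Sx.
have : h y @[y --> within S (nbhs x)] --> f x.
  by rewrite fh//; apply: cvg_within_filter; exact: (Ch 0 x Ux).
apply: cvg_trans; apply: near_eq_cvg; rewrite near_withinE.
by near=> y => Sy; apply/esym/fh => //; near: y; exact: open_near.
Unshelve. all: by end_near. Qed.

(** Charts are continuous only within their domain and image; this lemma and [near_cinv] carry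
    neighbourhoods across a chart in the two directions. *)
Lemma near_cmap c x (P : set 'rV[R]_n) : atlas X c -> cdom c x ->
  (\forall y \near cmap c x, P y) -> \forall z \near x, cdom c z /\ P (cmap c z).
Proof.
move=> Xc cx Py; have [oc _ _ /subspace_continuousP cc _] := atlas_chart Xc.
have H : \forall z \near x, cdom c z -> P (cmap c z) by exact: (cc x cx _ Py).
near=> z; have cz : cdom c z by near: z; exact: open_nbhs_nbhs.
by split => //; move: cz; near: z.
Unshelve. all: by end_near. Qed.

Lemma near_cimg c x : atlas X c -> cdom c x ->
  \forall y \near cmap c x, halfspace y -> cimg c y.
Proof.
move=> Xc cx; have [_ [U oU cE] _ _ _] := atlas_chart Xc.
have Ux : U (cmap c x).
  have : cimg c (cmap c x) by exists x.
  by rewrite cE => -[].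
near=> y => Hy; rewrite cE; split => //.
by near: y; exact: open_nbhs_nbhs.
Unshelve. all: by end_near. Qed.

Lemma cimg_halfspace c y : atlas X c -> cimg c y -> halfspace y.
Proof. by move=> Xc; have [_ [U _ ->] _ _ _] := atlas_chart Xc; case. Qed.

Lemma cimgK c y : atlas X c -> cimg c y -> cdom c (cinv c y) /\ cmap c (cinv c y) = y.
Proof.
move=> Xc [z cz <-]; have [_ _ cK _ _] := atlas_chart Xc.
by rewrite cK.
Qed.

Lemma near_cinv c x (P : set M) : atlas X c -> cdom c x ->
  (\forall z \near x, P z) -> \forall y \near cmap c x, cimg c y -> P (cinv c y).
Proof.
move=> Xc cx Px; have [_ _ cK _ /subspace_continuousP cc] := atlas_chart Xc.
have cix : cimg c (cmap c x) by exists x.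
have H : cinv c y @[y --> within (cimg c) (nbhs (cmap c x))] --> cinv c (cmap c x).
  exact: cc.
by rewrite cK// in H; exact: (H _ Px).
Qed.

Lemma smooth_fun_continuous u : smooth_fun X u -> continuous u.
Proof.
move=> su x; have [c Xc cx] := atlas_cover X x.
have [_ _ cK _ _] := atlas_chart Xc.
have cix : cimg c (cmap c x) by exists x.
have := smooth_on_cvg (su c Xc) cix; rewrite /= cK// => uc P Pu.
have H : \forall y \near cmap c x, cimg c y -> P (u (cinv c y)) by exact: (uc _ Pu).
have := near_cmap Xc cx H; apply: filterS => z [cz]; rewrite /= cK//; apply.
by exists z.
Qed.

Definition density c (y : 'rV[R]_n) : R := Num.sqrt (\det (gmat g c y)).

Lemma density_gt0 c y : atlas X c -> cimg c y -> 0 < density c y.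
Proof.
by move=> Xc cy; rewrite sqrtr_gt0; apply: posdef_det_gt0 => v; exact: gmat_pos.
Qed.

Lemma density_cvg c y : atlas X c -> cimg c y ->
  density c z @[z --> within (cimg c) (nbhs y)] --> density c y.
Proof.
move=> Xc cy; apply: (continuous_cvg _ (@sqrt_continuous R _)).
apply: cvg_det => i j.
exact: smooth_on_cvg (gmat_smooth g Xc i j) cy.
Qed.

End ManifoldTopology.

Section Volume.
Context {R : realType} {n : nat} {M : ptopologicalType}.
Variables (X : smooth_manifold R n M) (g : riemannian_metric X).
Variable vol : {measure set (borel M) -> \bar R}.
Hypothesis volE : is_riemannian_volume g vol.

Lemma open_measurable_borel (A : set M) : open A -> measurable (A : set (borel M)).
Proof. exact: sub_sigma_algebra. Qed.

Lemma row_of_ball (y : 'rV[R]_n) (e : R) (t : n.-tuple (measurableTypeR R)) :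
  0 < e -> (forall i, `|y 0 i - tnth t i| < e) -> ball y e (row_of t).
Proof.
move=> e0 ty; split => // i j; rewrite (ord1 i) /row_of mxE; exact: ty.
Qed.

(** Near a chart point the density stays above half of its positive value there, so the volume of
    [A] dominates a positive multiple of the Lebesgue measure of a small box. This makes the volume
    of M and the Rayleigh denominators positive. *)
Lemma vol_open_gt0 (A : set M) : open A -> A !=set0 -> (0 < vol A)%E.
Proof.
move=> oA [x Ax]; have [c Xc cx] := atlas_cover X x.
have [oc _ _ _ _] := atlas_chart Xc.
pose y := cmap c x; have cy : cimg c y by exists x.
have d0 := density_gt0 g Xc cy; set d := density g c y in d0.
have : \forall z \near y, halfspace z ->
    [/\ cimg c z, A (cinv c z) & d / 2 < density g c z].
  have d2 : d / 2 < d by rewrite ltr_pdivrMr// ltr_pMr// ltr1n.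
  have H1 : \forall z \near y, cimg c z -> d / 2 < density g c z.
    have dc := @density_cvg _ _ _ _ g _ _ Xc cy.
    have K := cvgr_gt _ dc _ d2; exact: K.
  have H2 := near_cimg Xc cx.
  have H3 := near_cinv Xc cx (open_nbhs_nbhs (conj oA Ax)).
  near=> z => Hz.
  have cz : cimg c z by move: Hz; near: z.
  split => //; first by move: cz; near: z.
  by move: cz; near: z.
move=> /nbhs_ballP[e /= e0 eP].
have mA : measurable (A `&` cdom c : set (borel M)).
  by apply: open_measurable_borel; exact: openI.
apply: (@lt_le_trans _ _ (vol (A `&` cdom c))); last first.
  apply: le_measure; last exact: subIsetl.
    by rewrite inE; exact: mA.
  by rewrite inE; exact: open_measurable_borel.
rewrite (volE Xc mA); last exact: subIsetr.
(* The box has its lower corner at [y] instead of being centred there: moving in positive directions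
   only, it stays in the half-space even when [y] is on the boundary. *)
pose B : set (n.-tuple (measurableTypeR R)) :=
  box (fun i => y 0 i) (fun i => y 0 i + e).
have BD t : B t -> (cmap c @` (A `&` cdom c)) (row_of t) /\ d / 2 < density g c (row_of t).
  move=> Bt.
  have /eP : ball y e (row_of t).
    apply: row_of_ball => // i; have /andP[t1 t2] := Bt i.
    by rewrite distrC ger0_norm ?subr_ge0 ?(ltW t1)// ltrBlDl.
  have Ht : halfspace (row_of t).
    move=> i i0; rewrite mxE; have /andP[t1 _] := Bt i.
    by apply: le_trans (ltW t1); exact: (cimg_halfspace Xc cy).
  move=> /(_ Ht)[ct At dt]; split => //.
  by have [ct1 ct2] := cimgK Xc ct; exists (cinv c (row_of t)).
rewrite integral_mkcond.
apply: (@lt_le_trans _ _ (\int[@lebesgue_tuple R n]_t ((d / 2)%:E * (\1_B t)%:E))%E).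
  rewrite ge0_integralZl//; last 2 first.
  - by apply/measurable_EFinP; apply: measurable_indic; exact: measurable_box.
  - by rewrite lee_fin divr_ge0// ltW.
  rewrite integral_indic//; last exact: measurable_box.
  rewrite setIT [X in (_ * X)%E]lebesgue_tuple_box; last by move=> i; rewrite lerDl ltW.
  rewrite lte_fin mulr_gt0 ?divr_gt0//.
  by apply: prodr_gt0 => i _; rewrite addrAC subrr add0r.
apply: ge0_le_integralT => t.
  by rewrite -EFinM lee_fin mulr_ge0// divr_ge0// ltW.
rewrite indicE; have [|] := boolP (t \in B); rewrite ?mule0 ?mule1.
  rewrite inE => /BD[tD td]; rewrite /patch mem_set//.
  by rewrite lee_fin ltW.
move=> _; rewrite /patch; case: ifP => // _; rewrite lee_fin sqrtr_ge0//.
Unshelve. all: by end_near. Qed.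

(** Each point has an open neighbourhood whose chart image lies in a bounded box and on which the
    density is below its value at the point plus 1; finitely many of them cover M. *)
Lemma vol_finite : compact [set: M] -> (vol setT < +oo)%E.
Proof.
move=> cM.
have H x : exists W : set M, [/\ open W, W x & (vol W < +oo)%E].
  have [c Xc cx] := atlas_cover X x.
  have [oc _ _ _ _] := atlas_chart Xc.
  pose y := cmap c x; have cy : cimg c y by exists x.
  set d := density g c y.
  have : \forall z \near y, cimg c z -> density g c z < d + 1.
    have d1 : d < d + 1 by rewrite ltrDl.
    have dc := @density_cvg _ _ _ _ g _ _ Xc cy.
    have K := cvgr_lt _ dc _ d1; exact: K.
  move=> /nbhs_ballP[e /= e0 eP].
  pose W : set M := [set z | cdom c z /\ ball y e (cmap c z)].
  have xW : \forall z \near x, W z.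
    by apply: (near_cmap Xc cx (P := ball y e)); exact: (nbhsx_ballx y e e0).
  exists W^°; split; [exact: open_interior|exact: xW|].
  have mW : measurable (W^° : set (borel M)).
    by apply: open_measurable_borel; exact: open_interior.
  rewrite (volE Xc mW); last by move=> z /interior_subset [].
  pose B : set (n.-tuple (measurableTypeR R)) :=
    box (fun i => y 0 i - e) (fun i => y 0 i + e).
  rewrite integral_mkcond.
  apply: (@le_lt_trans _ _ (\int[@lebesgue_tuple R n]_t ((d + 1)%:E * (\1_B t)%:E))%E).
    apply: ge0_le_integralT => t.
      by rewrite /patch; case: ifP => // _; rewrite lee_fin sqrtr_ge0.
    rewrite /patch; case: ifPn => [|_]; last first.
      by rewrite -EFinM lee_fin mulr_ge0// addr_ge0// sqrtr_ge0.
    rewrite inE => -[z /interior_subset[cz yz] zt].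
    rewrite indicE mem_set ?mule1.
      by rewrite lee_fin ltW//; apply: eP; rewrite -zt//; exists z.
    move=> i; have [_ /(_ 0 i)] := yz; rewrite zt mxE /ball /= distrC ltr_norml.
    by rewrite ltrBlDl ltrBrDl [y 0 i - e]addrC.
  rewrite ge0_integralZl//; last 2 first.
  - by apply/measurable_EFinP; apply: measurable_indic; exact: measurable_box.
  - by rewrite lee_fin addr_ge0// sqrtr_ge0.
  rewrite integral_indic//; last exact: measurable_box.
  rewrite setIT [X in (_ * X)%E]lebesgue_tuple_box ?ltry// => i.
  by rewrite lerD2l ge0_cp// ltW.
have [W WP] := choice H.
move: cM; rewrite compact_cover => /(_ M setT W).
case=> [x _|x _|D _ MD]; [by have [] := WP x|by exists x => //; have [] := WP x|].
have -> : [set: M] = \big[setU/set0]_(x <- finmap.enum_fset D) W x.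
  apply/seteqP; split => // z _; have [x xD Wx] := MD z I.
  by rewrite -bigcup_seq; exists x.
have : measurable (\big[setU/set0]_(x <- finmap.enum_fset D) W x : set (borel M)) /\
    (vol (\big[setU/set0]_(x <- finmap.enum_fset D) W x) < +oo)%E.
  elim/big_ind : _ => [|A B [mA vA] [mB vB]|x _].
  - by rewrite measure0.
  - split; first exact: measurableU.
    by apply: le_lt_trans (measureU2 _ _ _) _ => //; rewrite lte_add_pinfty.
  - by have [oW _ vW] := WP x; split => //; exact: open_measurable_borel.
by case.
Qed.

End Volume.

(** * Measurable minorants and medians *)

Section MeasurableMinorant.
Context d (T : measurableType d) (R : realType) (mu : {measure set T -> \bar R}).
Local Open Scope ereal_scope.
Import HBNNSimple.

(* As |grad u| is computed in arbitrarily chosen charts, its measurability is not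
   immediate; a largest measurable minorant (up to null sets) has the same
   weighted integrals and avoids the question. *)
Lemma measurable_minorant (G : T -> R) : (forall x, (0 <= G x)%R) ->
  \int[mu]_x (G x)%:E < +oo ->
  exists H : T -> R, [/\ measurable_fun setT H, (forall x, (0 <= H x <= G x)%R) &
    forall k : T -> R, measurable_fun setT k -> (forall x, (0 <= k x)%R) ->
      \int[mu]_x (k x * G x)%:E <= \int[mu]_x (k x * H x)%:E].
Proof.
move=> G0 Gfin; pose I : \bar R := \int[mu]_x (G x)%:E; rewrite -/I in Gfin.
have I0 : 0 <= I by apply: integral_ge0 => x _; rewrite lee_fin.
have Ifin : I \is a fin_num by rewrite ge0_fin_numE.
have IE : I = ereal_sup [set sintegral mu h | h in
    [set h : {nnsfun T >-> R} | forall x, (h x)%:E <= (G x)%:E]].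
  by rewrite /I ge0_integralTE// => x; rewrite lee_fin.
(* Simple functions below [G] whose integrals approach that of [G]; their pointwise supremum is the
   minorant [H], measurable and with the full integral [I]. *)
have [h hP] : exists h : nat -> {nnsfun T >-> R}, forall n,
    (forall x, (h n x <= G x)%R) /\ I - (n.+1%:R^-1)%:E < \int[mu]_x (h n x)%:E.
  suff /choice[h hP] : forall n : nat, exists f : {nnsfun T >-> R},
      (forall x, (f x <= G x)%R) /\ I - (n.+1%:R^-1)%:E < \int[mu]_x (f x)%:E.
    by exists h.
  move=> n.
  have n0 : (0 < n.+1%:R^-1 :> R)%R by rewrite invr_gt0.
  rewrite IE in Ifin *; have [_ [f fG <-] If] := ub_ereal_sup_adherent n0 Ifin.
  exists f; split; first by move=> x; rewrite -lee_fin.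
  by rewrite integral_nnsfun// patch_setT.
have ub x : has_ubound (range (h ^~ x)) by exists (G x) => _ [n _ <-]; exact: (hP n).1.
pose H x := sups (h ^~ x) 0%N.
have Hsup x : H x = sup (range (h ^~ x)).
  by rewrite /H /sups /sdrop; congr sup; apply/seteqP; split => y [n _ <-]; exists n.
have mH : measurable_fun setT H by apply: measurable_fun_sups.
have hH n x : (h n x <= H x)%R.
  by rewrite Hsup; apply: sup_ubound => //; exists n.
have H0 x : (0 <= H x)%R by apply: le_trans (hH 0%N x).
have HG x : (H x <= G x)%R.
  rewrite Hsup; apply: ge_sup; first by exists (h 0%N x), 0%N.
  by move=> _ [n _ <-]; exact: (hP n).1.
have maxI (F : T -> R) : (forall x, (0 <= F x <= G x)%R) -> \int[mu]_x (F x)%:E <= I.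
  move=> FG; apply: ge0_le_integralT => x; have /andP[F0 F1] := FG x; rewrite lee_fin//.
have IH : \int[mu]_x (H x)%:E = I.
  apply/eqP; rewrite eq_le maxI ?H0 ?HG//=; last by move=> x; rewrite H0 HG.
  apply/lee_addgt0Pr => e e0.
  pose n := Num.truncn e^-1.
  have ne : (n.+1%:R^-1 <= e)%R.
    rewrite -[leRHS]invrK lef_pV2 ?posrE ?invr_gt0//.
    by rewrite ltW// truncnS_gt.
  have := (hP n).2; rewrite lteBlDr// => /ltW/le_trans; apply.
  apply: leeD; last by rewrite lee_fin.
  by apply: ge0_le_integralT => x; rewrite lee_fin.
exists H; split => // [x|k mk k0]; first by rewrite H0 HG.
rewrite [leLHS]ge0_integralTE; last by move=> x; rewrite lee_fin mulr_ge0.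
apply: ge_ereal_sup => _ [s sG <-].
have -> : sintegral mu s = \int[mu]_x (s x)%:E by rewrite integral_nnsfun// patch_setT.
(* The quotient [s / k] is a measurable function below [G]. Then so is its maximum with [H], whose
   integral cannot exceed [I], the integral of [H]; hence [f <= H] almost everywhere. *)
pose f x := (s x * (k x) `^ (- 1))%R.
have fE x : f x = (s x / k x)%R by rewrite /f powR_inv1.
have f0 x : (0 <= f x)%R by rewrite mulr_ge0 ?powR_ge0.
have fG x : (f x <= G x)%R.
  rewrite fE; have [->|kx] := eqVneq (k x) 0%R; first by rewrite invr0 mulr0.
  rewrite ler_pdivrMr ?lt_neqAle ?k0 1?eq_sym ?kx//.
  by have := sG x; rewrite lee_fin mulrC.
have mf : measurable_fun setT f.
  apply: measurable_funM => //.
  exact: (measurableT_comp (measurable_powR _)).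
pose D x := (Num.max (f x) (H x) - H x)%R.
have D0 x : (0 <= D x)%R by rewrite subr_ge0 le_max lexx orbT.
have mD : measurable_fun setT D.
  by apply: measurable_funB => //; exact: measurable_maxr.
have ID : \int[mu]_x `|(D x)%:E| = 0.
  under eq_integral => x _ do rewrite gee0_abs ?lee_fin//.
  apply/eqP; rewrite eq_le integral_ge0 ?andbT; last by move=> x _; rewrite lee_fin.
  rewrite -(@leeD2lE _ I)// adde0 -[in leLHS]IH.
  rewrite -ge0_integralD//; last 4 first.
  - by move=> x _; rewrite lee_fin.
  - exact/measurable_EFinP.
  - by move=> x _; rewrite lee_fin.
  - exact/measurable_EFinP.
  under eq_integral => x _ do rewrite -EFinD /D addrC subrK.
  by apply: maxI => x; rewrite le_max f0/= ge_max fG HG.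
have mED : measurable_fun setT (EFin \o D) by exact/measurable_EFinP.
have D0ae := (ae_eq_integral_abs mu measurableT mED).1 ID.
apply: ae_ge0_le_integral => //.
- by move=> x _; rewrite lee_fin.
- exact/measurable_EFinP.
- by move=> x _; rewrite lee_fin mulr_ge0.
- by apply/measurable_EFinP; exact: measurable_funM.
- apply: filterS D0ae => x /(_ Logic.I) [] /eqP; rewrite subr_eq0 => /eqP fH _.
  have fHx : (f x <= H x)%R by rewrite -fH le_max lexx.
  (* Where [k] vanishes [f] carries no information, but there the bound on [s] by k G already reads
     [s x <= 0]. *)
  rewrite lee_fin; have [kx|kx] := eqVneq (k x) 0%R.
    by have := sG x; rewrite lee_fin kx !mul0r.
  apply: le_trans (ler_wpM2l (k0 x) fHx).
  by rewrite fE mulrCA divff// mulr1.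
Qed.

End MeasurableMinorant.

Section Median.
Context d (T : measurableType d) (R : realType) (mu : {measure set T -> \bar R}).
Hypothesis mufin : (mu setT < +oo)%E.
Implicit Types u : T -> R.

Lemma measurable_ger u (a : R) : measurable_fun setT u ->
  measurable [set x | a <= u x].
Proof.
move=> meas_u; rewrite (_ : [set x | _] = u @^-1` `[a, +oo[).
  by rewrite -[X in measurable X]setTI; exact: meas_u.
by apply/seteqP; split => x /=; rewrite in_itv /= andbT.
Qed.

Lemma measurable_ler u (a : R) : measurable_fun setT u ->
  measurable [set x | u x <= a].
Proof.
move=> meas_u; rewrite (_ : [set x | _] = u @^-1` `]-oo, a]).
  by rewrite -[X in measurable X]setTI; exact: meas_u.
by apply/seteqP; split => x /=; rewrite in_itv.
Qed.

Lemma measurable_gtr u (a : R) : measurable_fun setT u ->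
  measurable [set x | a < u x].
Proof.
move=> meas_u; rewrite (_ : [set x | _] = u @^-1` `]a, +oo[).
  by rewrite -[X in measurable X]setTI; exact: meas_u.
by apply/seteqP; split => x /=; rewrite in_itv /= andbT.
Qed.

(** Continuity from above of a finite measure along the sublevel sets at heights c + t/(k+2); the
    offset 2 keeps every shift strictly below [t]. *)
Lemma sublevel_right_continuous u (a : \bar R) (c t : R) : measurable_fun setT u ->
  0 < t -> (forall s, 0 < s < t -> (a <= mu [set x | u x <= c + s]%R)%E) ->
  (a <= mu [set x | u x <= c]%R)%E.
Proof.
move=> meas_u t0 H; pose F (k : nat) := [set x | u x <= c + t / k.+2%:R].
have FE : \bigcap_k F k = [set x | u x <= c].
  apply/seteqP; split => x /= Hx; last first.
    by move=> k _; rewrite /F /= (le_trans Hx)// lerDl divr_ge0// ltW.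
  apply/ler_addgt0Pr => e e0; pose k := Num.truncn (t / e).
  have := Hx k I; rewrite /F /= => /le_trans; apply; rewrite lerD2l.
  rewrite ler_pdivrMr// -ler_pdivrMl// mulrC.
  by rewrite ltW// (lt_trans (truncnS_gt _))// ltr_nat.
have mF k : measurable (F k) by exact: measurable_ler.
have := @nonincreasing_cvg_mu _ _ _ mu F.
rewrite FE => /(_ _ mF (measurable_ler _ meas_u) _) cvgF.
have {}cvgF : (mu \o F) x @[x --> \oo] --> mu [set x | u x <= c].
  apply: cvgF.
    by apply: le_lt_trans mufin; apply: le_measure; rewrite ?inE.
  move=> n m nm; apply/subsetPset => x; rewrite /F /= => /le_trans; apply.
  by rewrite lerD2l ler_wpM2l ?(ltW t0)// lef_pV2 ?posrE// ler_nat.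
rewrite -(cvg_lim _ cvgF)//; apply: lime_ge; first by apply/cvg_ex; eexists; exact: cvgF.
apply: nearW => k; apply: H; rewrite divr_gt0//= ltr_pdivrMr// ltr_pMr// ltr1n//.
Qed.

(** The median is the infimum of the heights a with mu{u > a} <= mu{u <= a}. Boundedness of [u] and
    positive total mass make this set nonempty and bounded below. The gap [t] gives exactly the
    disjoint closed level sets to which the capacity is applied. *)
Lemma median u (B : R) : measurable_fun setT u -> (forall x, `|u x| <= B) ->
  (0 < mu setT)%E ->
  exists c : R, forall t, 0 < t ->
    (mu [set x | c + t <= u x]%R <= mu [set x | u x <= c]%R)%E /\
    (mu [set x | u x <= c - t]%R <= mu [set x | c <= u x]%R)%E.
Proof.
move=> meas_u uB mu0; pose S := [set a : R | (mu [set x | a < u x]%R <= mu [set x | u x <= a]%R)%E].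
have le_mu (P Q : set T) : measurable P -> measurable Q -> P `<=` Q -> (mu P <= mu Q)%E.
  by move=> mP mQ PQ; apply: le_measure; rewrite ?inE.
have SB : S B.
  rewrite /S /= (_ : [set x | B < u x] = set0) ?measure0//.
  apply/seteqP; split => // x /=; rewrite ltNge; move/negP; apply.
  exact: le_trans (ler_norm _) (uB x).
have Slb : lbound S (- B).
  move=> a Sa; rewrite leNgt; apply/negP => aB; move: Sa; rewrite /S /=.
  rewrite [X in (_ <= mu X)%E](_ : _ = set0); last first.
    apply/seteqP; split => // x /= ua; have := lt_le_trans aB (lerNnormlW (uB x)).
    by rewrite ltNge ua.
  rewrite [X in (mu X <= _)%E](_ : _ = setT); last first.
    apply/seteqP; split => // x _ /=; exact: lt_le_trans aB (lerNnormlW (uB x)).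
  by rewrite measure0 leNgt mu0.
have Sinf : has_inf S by split; [exists B|exists (- B)].
exists (inf S) => t t0; split.
- apply: (sublevel_right_continuous meas_u t0) => s /andP[s0 st].
  have [a Sa ac] := inf_adherent s0 Sinf.
  apply: (@le_trans _ _ (mu [set x | a < u x])).
    apply: le_mu; [exact: measurable_ger|exact: measurable_gtr|].
    move=> x /=; apply: lt_le_trans; rewrite (lt_trans ac)// ltrD2l//.
  apply: (le_trans Sa); apply: le_mu; [exact: measurable_ler|exact: measurable_ler|].
  by move=> x /= /le_trans; apply; exact: ltW.
- have E r : [set x | r <= u x] = [set x | (\- u) x <= - r].
    by apply/seteqP; split => x /=; rewrite lerN2.
  rewrite [X in (_ <= mu X)%E]E.
  apply: (@sublevel_right_continuous (\- u) _ _ t) => // [|s /andP[s0 st]].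
    exact: measurableT_comp.
  rewrite (_ : - inf S + s = - (inf S - s)); last by rewrite opprB addrC.
  rewrite -E.
  (* Strictly below the infimum the defining inequality fails, hence holds reversed; right
     continuity, applied to -u, then lets [s] tend to 0. *)
  have /negP : ~ S (inf S - s).
    by move=> /(ge_inf Sinf.2); rewrite lerBrDl gerDr leNgt s0.
  rewrite -ltNge => /ltW H.
  apply: le_trans (le_trans H _).
    apply: le_mu; [exact: measurable_ler|exact: measurable_ler|].
    by move=> x /= /le_trans; apply; rewrite lerD2l lerN2 ltW.
  apply: le_mu; [exact: measurable_gtr|exact: measurable_ger|].
  by move=> x /=; exact: ltW.
Qed.

End Median.

(** * The capacitary inequality *)

(** The power with exponent -1 is the inverse on nonnegative arguments, hence the detour through the
    square; at 0 both sides are 0. *)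
Lemma measurable_inv (R : realType) : measurable_fun setT (fun t : R => t^-1).
Proof.
have -> : (fun t : R => t^-1) = fun t => t * (t * t) `^ (-1).
  apply/funext => t; rewrite powR_inv1 ?invfM; last by rewrite -expr2 sqr_ge0.
  by have [->|t0] := eqVneq t 0; rewrite ?invr0 ?mul0r// mulrA divff// mul1r.
apply: measurable_funM => //; apply: (measurableT_comp (measurable_powR _)).
exact: measurable_funM.
Qed.

Section CapacitaryInequality.
Context d (T : measurableType d) (R : realType).
Variable mu : {sigma_finite_measure set T -> \bar R}.
Notation leb := (@lebesgue_measure R).
Notation RT := (measurableTypeR R).
Variables (p K gamma : R) (v H : T -> R) (h Phi : R -> R).
Hypotheses (p1 : 1 < p) (K0 : 0 <= K) (gamma0 : 0 <= gamma).
Hypotheses (mv : measurable_fun setT v) (mH : measurable_fun setT H)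
  (H0 : forall x, 0 <= H x).
Hypotheses (ch : continuous h) (dPhi : forall x : R, is_derive x 1 Phi (h x))
  (h0 : forall x, 0 <= h x) (hout : forall x, ~~ (0 < x < 1) -> h x = 0)
  (Phi0 : forall x, x <= 0 -> Phi x = 0) (Phi1 : forall x, 1 <= x -> Phi x = 1)
  (hp : forall x, 0 < x -> p * h x `^ p <= K * (x * h x)).

Let p0 : 0 < p. Proof. exact: lt_trans p1. Qed.

Definition layer (x : T) (t : R) : R :=
  p * t `^ (p - 1) * \1_[set t : R | 0 < t <= v x] t.

(** The bound that [hp] at [v x / t] gives for p t^(p-1) times the energy density t^-p h(v/t)^p H.
    It is linear in [h], which makes its integral over [t] computable. *)
Definition energy_layer (x : T) (t : R) : R :=
  K * H x * (v x * (t^-1) ^+ 2 * h (v x * t^-1) * \1_[set t : R | 0 < t] t).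

Lemma layer_ge0 x t : 0 <= layer x t.
Proof. by rewrite /layer !mulr_ge0 ?powR_ge0 ?(ltW p0). Qed.

Lemma energy_layer_ge0 x t : 0 <= energy_layer x t.
Proof.
rewrite /energy_layer indicE; have [|] := boolP (t \in _); last by rewrite !mulr0.
rewrite inE /= => t0; rewrite mulr1; apply: mulr_ge0; first exact: mulr_ge0.
have [y0|y0] := leP (v x) 0; last first.
  apply: mulr_ge0 => //; apply: mulr_ge0; [exact: ltW|exact: sqr_ge0].
rewrite [h _]hout ?mulr0// negb_and -leNgt.
by rewrite mulr_le0_ge0// invr_ge0 ltW.
Qed.

Lemma integral_layer x : (\int[leb]_t (layer x t)%:E = (Num.max (v x) 0 `^ p)%:E)%E.
Proof.
have [v0|v0] := leP (v x) 0.
  rewrite powR0 ?gt_eqF// integral0_eq// => t _; congr EFin.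
  rewrite /layer indicE memNset ?mulr0//= => /andP[t0 tv].
  by move: (lt_le_trans t0 tv); rewrite ltNge v0.
rewrite -integral_powR//.
rewrite -integral_itv_obnd_cbnd; last first.
  apply/measurable_EFinP; apply: measurable_funTS.
  by apply: measurable_funM => //; exact: measurable_powR.
rewrite [RHS]integral_mkcond; apply: eq_integral => t _.
rewrite /layer indicE /patch; case: ifPn => tv.
  by rewrite mulr1.
by rewrite mulr0.
Qed.

(** The substitution r = y/t in the integral of [h] over the unit interval: the integrand is the
    derivative of -Phi(y/t), which runs from -1 at t = y to 0 at infinity. *)
Lemma integral_scaled_profile (y : R) : 0 < y ->
  (\int[leb]_(t in `[y, +oo[) (y * (t^-1) ^+ 2 * h (y * t^-1))%:E = 1)%E.
Proof.
move=> y0; pose F (t : R) := - Phi (y * t^-1).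
have dF (t : R) : 0 < t -> is_derive t 1 F (y * (t^-1) ^+ 2 * h (y * t^-1)).
  move=> t0; have tN0 : t != 0 by rewrite gt_eqF.
  have d1 : is_derive t 1 (fun s : R => s^-1) (- t ^- 2).
    by apply: is_derive_eq; [exact: is_deriveV|rewrite /= -[_ *: _]/(_ * _) mulr1].
  have d2 := is_deriveN (@is_derive1_comp _ Phi _ _ _ _ (dPhi _) (is_deriveZ y d1)).
  apply: (is_derive_eq d2); rewrite -![_ *: _]/(_ * _) exprVn.
  rewrite (_ : (y \*: _) t = y / t)//; ring.
have fc (t : R) : 0 < t ->
    {for t, continuous (fun s : R => y * (s^-1) ^+ 2 * h (y * s^-1))}.
  move=> t0; have tN0 : t != 0 by rewrite gt_eqF.
  have cV : (s^-1 : R) @[s --> t] --> t^-1 by apply: cvgV => //; exact: cvg_id.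
  have cyV : y * s^-1 @[s --> t] --> y * t^-1 by apply: cvgM => //; exact: cvg_cst.
  have hc : h (y * s^-1) @[s --> t] --> h (y * t^-1) .
    exact: (cvg_comp _ _ cyV (@ch (y * t^-1))).
  have cV2 : (s^-1) ^+ 2 @[s --> t] --> (t^-1) ^+ 2 by exact: cvgM.
  by apply: (cvgM _ hc); apply: (cvgM _ cV2); exact: cvg_cst.
rewrite (@ge0_continuous_FTC2y _ _ F _ 0).
- by rewrite /F divff ?gt_eqF// Phi1// sub0e EFinN oppeK.
- move=> t yt; have t0 : 0 < t := lt_le_trans y0 yt.
  apply: mulr_ge0 => //; apply: mulr_ge0; [exact: ltW|exact: sqr_ge0].
- apply: continuous_in_subspaceT => t; rewrite inE /= in_itv /= andbT => yt.
  exact: fc (lt_le_trans y0 yt).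
- have c0 : y * t^-1 @[t --> +oo] --> y * 0.
    apply: cvgM; first exact: cvg_cst.
    by apply/gtr0_cvgV0; [exact: nbhs_pinfty_gt|exact: cvg_id].
  rewrite mulr0 in c0.
  have cPhi : {for 0, continuous Phi} by exact: is_derive_continuous (dPhi 0).
  have := cvg_comp _ _ c0 cPhi; rewrite Phi0// => /cvgN.
  by rewrite oppr0.
- by move=> t yt; exact: (@ex_derive _ _ _ _ _ _ _ (dF t (lt_trans y0 yt))).
- by apply: cvg_at_right_filter; apply: is_derive_continuous (dF _ y0).
- move=> t; rewrite in_itv /= andbT => yt; rewrite derive1E.
  by apply: derive_val; apply: dF; exact: lt_trans yt.
Qed.

Lemma integral_energy_layer x :
  (\int[leb]_t (energy_layer x t)%:E = (K * H x * \1_[set x | (0 < v x)%R] x)%:E)%E.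
Proof.
have [v0|v0] := leP (v x) 0.
  rewrite indicE memNset ?mulr0; last by rewrite /= ltNge v0.
  apply: integral0_eq => t _; congr EFin.
  rewrite /energy_layer indicE; have [|] := boolP (t \in _); last by rewrite !mulr0.
  rewrite inE /= => t0; rewrite [h _]hout ?mulr0 ?mul0r ?mulr0// negb_and -leNgt.
  by rewrite mulr_le0_ge0// invr_ge0 ltW.
rewrite indicE mem_set ?mulr1//.
transitivity (\int[leb]_t ((K * H x)%:E *
  ((fun t => (v x * (t^-1) ^+ 2 * h (v x * t^-1))%:E) \_ `[v x, +oo[) t))%E.
  apply: eq_integral => t _; rewrite /energy_layer EFinM; congr (_ * _)%E.
  rewrite /patch indicE; case: ifPn => tv.
    move: tv; rewrite inE /= in_itv /= andbT => vt.
    by rewrite mem_set ?mulr1//=; exact: lt_le_trans vt.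
  have [|] := boolP (t \in _); last by rewrite mulr0.
  rewrite inE /= => t0; rewrite mulr1 [h _]hout ?mulr0// negb_and.
  apply/orP; right; rewrite -leNgt ler_pdivlMr// mul1r ltW//.
  by rewrite ltNge; apply: contra tv => vt; rewrite inE /= in_itv /= vt.
have f0 t : (0%R <= ((fun t => (v x * (t^-1) ^+ 2 * h (v x * t^-1))%R%:E) \_ `[v x, +oo[) t)%E.
  rewrite /patch; case: ifPn => //; rewrite inE /= in_itv /= andbT => vt.
  rewrite lee_fin; apply: mulr_ge0 => //; apply: mulr_ge0; [exact: ltW|exact: sqr_ge0].
rewrite ge0_integralZl//.
- by rewrite -integral_mkcond integral_scaled_profile// mule1.
- apply/(measurable_restrictT _ _).1 => //.
  apply/measurable_EFinP; apply: measurable_funTS.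
  have mi := @measurable_inv R.
  apply: measurable_funM; first by apply: measurable_funM => //; exact: measurable_funX.
  apply: (measurableT_comp (continuous_measurable_fun ch)).
  exact: measurable_funM.
- by rewrite lee_fin mulr_ge0.
Qed.

Lemma measurable_layer :
  measurable_fun setT (fun z : T * RT => (layer z.1 z.2)%:E).
Proof.
apply/measurable_EFinP; apply: measurable_funM.
  apply: measurable_funM => //.
  exact: (measurableT_comp (measurable_powR _)).
rewrite (_ : (fun z : T * RT => _) = \1_[set z : T * RT | 0 < z.2 <= v z.1]); last first.
  by apply/funext => z; rewrite !indicE; congr ((_ : bool)%:R); apply/idP/idP; rewrite !inE.
apply: measurable_indic.
rewrite (_ : [set z : T * RT | _] = [set z | 0 < z.2] `&` [set z : T * RT | 0 <= v z.1 - z.2]).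
  apply: measurableI.
    exact: (@measurable_gtr _ _ R (fun z : T * RT => z.2) 0 measurable_snd).
  apply: (@measurable_ger _ _ R (fun z : T * RT => v z.1 - z.2) 0).
  apply: measurable_funB => //.
  exact: measurableT_comp.
by apply/seteqP; split => z /=; rewrite subr_ge0; [move/andP|move=> ?; apply/andP].
Qed.

Lemma measurable_energy_layer :
  measurable_fun setT (fun z : T * RT => (energy_layer z.1 z.2)%:E).
Proof.
have mv1 : measurable_fun setT (fun z : T * RT => v z.1) by exact: measurableT_comp.
have mi2 : measurable_fun setT (fun z : T * RT => (z.2 : R)^-1).
  exact: (measurableT_comp (@measurable_inv R)).
apply/measurable_EFinP; apply: measurable_funM.
  by apply: measurable_funM => //; exact: measurableT_comp.
apply: measurable_funM.
  apply: measurable_funM; first by apply: measurable_funM => //; exact: measurable_funX.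
  apply: (measurableT_comp (continuous_measurable_fun ch)).
  exact: measurable_funM.
rewrite (_ : (fun z : T * RT => _) = \1_[set z : T * RT | 0 < z.2]); last first.
  by apply/funext => z; rewrite !indicE; congr ((_ : bool)%:R); apply/idP/idP; rewrite !inE.
apply: measurable_indic.
exact: (@measurable_gtr _ _ R (fun z : T * RT => z.2) 0 measurable_snd).
Qed.

(** The estimate obtained by testing the capacity of the level [t] with Phi(v/t), where [H] stands
    for the p-th power of the gradient norm. *)
Hypothesis cap : forall t, 0 < t ->
  (gamma%:E * mu [set x | t <= v x]%R <=
   \int[mu]_x ((t^-1 * h (v x * t^-1)) `^ p * H x)%:E)%E.

Lemma capacitary_inequality :
  (gamma%:E * \int[mu]_x (Num.max (v x) 0 `^ p)%:E <=
   K%:E * \int[mu]_x (H x * \1_[set x | (0 < v x)%R] x)%:E)%E.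
Proof.
have -> : (\int[mu]_x (Num.max (v x) 0 `^ p)%:E = \int[leb]_t \int[mu]_x (layer x t)%:E)%E.
  under eq_integral do rewrite -integral_layer.
  apply: (@fubini_tonelli _ _ _ _ R mu leb _ measurable_layer) => z.
  by rewrite lee_fin layer_ge0.
have mfl := @measurable_fun_fubini_tonelli_G _ _ _ _ R mu _ measurable_layer
  (fun z => layer_ge0 z.1 z.2).
rewrite -ge0_integralZl//; last first.
  by move=> t _; apply: integral_ge0 => x _; rewrite lee_fin layer_ge0.
have -> : (K%:E * \int[mu]_x (H x * \1_[set x | (0 < v x)%R] x)%:E =
   \int[leb]_t \int[mu]_x (energy_layer x t)%:E)%E.
  rewrite -ge0_integralZl//; last 2 first.
  - apply/measurable_EFinP; apply: measurable_funM => //.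
    apply: measurable_indic; exact: measurable_gtr.
  - by move=> x _; rewrite lee_fin mulr_ge0.
  rewrite -(@fubini_tonelli _ _ _ _ R mu leb _ measurable_energy_layer); last first.
    by move=> z; rewrite lee_fin energy_layer_ge0.
  by apply: eq_integral => x _; rewrite integral_energy_layer -EFinM mulrA.
(* The inner integrals are now compared for each [t]. For t <= 0 the left one vanishes; for t > 0,
   [cap] is multiplied by p t^(p-1) and [hp] is applied at v/t. *)
apply: ge0_le_integralT => t.
  rewrite mule_ge0 ?lee_fin//; apply: integral_ge0 => x _; rewrite lee_fin layer_ge0//.
have [t0|t0] := leP t 0.
  rewrite (_ : (\int[mu]_x (layer x t)%:E = 0)%E).
    by rewrite mule0; apply: integral_ge0 => x _; rewrite lee_fin energy_layer_ge0.
  apply: integral0_eq => x _; rewrite /layer indicE memNset ?mulr0//=.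
  by rewrite ltNge t0.
have layerE : (\int[mu]_x (layer x t)%:E =
    (p * t `^ (p - 1))%:E * mu [set x | t <= v x]%R)%E.
  rewrite -[in RHS](setIT [set x | t <= v x]) -integral_indic//; last first.
    exact: measurable_ger.
  rewrite -ge0_integralZl//.
  - apply: eq_integral => x _; rewrite /layer -EFinM; congr (_ * _)%:E.
    by rewrite !indicE; congr ((_ : bool)%:R); apply/idP/idP; rewrite !inE /= t0.
  - by apply/measurable_EFinP; apply: measurable_indic; exact: measurable_ger.
  - by rewrite lee_fin mulr_ge0 ?powR_ge0 ?(ltW p0).
rewrite layerE muleCA.
have c0 : 0 <= p * t `^ (p - 1) by rewrite mulr_ge0 ?powR_ge0 ?(ltW p0).
apply: (le_trans (lee_wpmul2l _ (cap t0))); first by rewrite lee_fin.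
have mi x : (t^-1 * h (v x * t^-1)) `^ p = (t `^ p)^-1 * h (v x * t^-1) `^ p.
  rewrite powRM ?invr_ge0 ?(ltW t0)//; congr (_ * _).
  by rewrite -powR_inv1 ?(ltW t0)// powRAC powR_inv1 ?powR_ge0.
have mhv : measurable_fun setT (fun x => h (v x * t^-1)).
  by apply: (measurableT_comp (continuous_measurable_fun ch)); exact: measurable_funM.
rewrite -ge0_integralZl//; last 2 first.
- apply/measurable_EFinP; apply: measurable_funM => //.
  apply: (measurableT_comp (measurable_powR _)).
  exact: measurable_funM.
- by move=> x _; rewrite lee_fin mulr_ge0 ?powR_ge0.
apply: ge0_le_integralT => x; rewrite -EFinM lee_fin.
  by apply: mulr_ge0 => //; rewrite mulr_ge0 ?powR_ge0.
rewrite mi /energy_layer indicE mem_set ?mulr1//.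
(* Where v <= 0 the ratio v/t lies outside the support of [h], so only the energy on {v > 0} is
   counted. *)
have [v0|v0] := leP (v x) 0.
  rewrite hout; last first.
    by rewrite negb_and -leNgt mulr_le0_ge0// invr_ge0 ltW.
  by rewrite powR0 ?gt_eqF// !(mulr0, mul0r).
have := hp (divr_gt0 v0 t0).
have -> : p * t `^ (p - 1) * ((t `^ p)^-1 * h (v x / t) `^ p * H x) =
    (t^-1 * H x) * (p * h (v x / t) `^ p).
  rewrite -(mulr_powRB1 (ltW t0) p0); field.
  by rewrite !gt_eqF// powR_gt0.
move=> /(ler_wpM2l (_ : 0 <= t^-1 * H x))/le_trans; apply.
  by rewrite mulr_ge0 ?invr_ge0 ?(ltW t0).
by rewrite le_eqVlt; apply/orP; left; apply/eqP; ring.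
Qed.

End CapacitaryInequality.

(** * Test functions and deviations *)

Section TestFunctions.
Context {R : realType} {n : nat} {M : ptopologicalType}.
Variables (X : smooth_manifold R n M) (g : riemannian_metric X).

Lemma smooth_fun_comp (psi : R -> R) (u : M -> R) :
  (forall k, class_C k psi) -> smooth_fun X u -> smooth_fun X (psi \o u).
Proof.
by move=> Cpsi su c Xc; apply: (smooth_on_comp Cpsi (su c Xc)).
Qed.

(** Both gradients are computed in the same chart at [x], where all partial derivatives acquire the
    common factor [dpsi (u x)] and the quadratic form its square. *)
Lemma grad_norm_comp (psi dpsi : R -> R) (u : M -> R) x :
  (forall y : R, is_derive y 1 psi (dpsi y)) -> smooth_fun X u ->
  grad_norm g (psi \o u) x = `|dpsi (u x)| * grad_norm g u x.
Proof.
move=> dpsiP su; rewrite /grad_norm /grad; set c := chart_at X x.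
have [Xc cx] : atlas X c /\ cdom c x by rewrite /c /chart_at; case: cid2.
have [_ [U oU cE] cK _ _] := atlas_chart Xc.
have cix : cimg c (cmap c x) by exists x.
have -> : (\row_j pderiv j (psi \o u \o cinv c) (cmap c x)) =
    dpsi (u x) *: (\row_j pderiv j (u \o cinv c) (cmap c x)).
  apply/rowP => j; rewrite !mxE.
  rewrite (@pderiv_comp _ _ (cimg c) psi dpsi (u \o cinv c))//=.
  - by rewrite cK.
  - by exists U.
  - exact: su.
set r := \row_j _; set G := gmat g c _; set a := dpsi _.
rewrite -scalemxAl; set w := r *m _.
rewrite linearZ /= -scalemxAr -!scalemxAl scalerA mxE.
by rewrite sqrtrM -?expr2 ?sqr_ge0// sqrtr_sqr.
Qed.

Lemma grad_norm_ge0 u x : 0 <= grad_norm g u x.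
Proof. exact: sqrtr_ge0. Qed.

Lemma dirichlet_energy_ge0 (vol : {measure set (borel M) -> \bar R}) p u :
  (0 <= dirichlet_energy g vol p u)%E.
Proof. by apply: integral_ge0 => x _; rewrite lee_fin powR_ge0. Qed.

Lemma continuous_measurable_borel (u : M -> R) : continuous u ->
  measurable_fun setT (u : borel M -> R).
Proof.
move=> cu; apply: (measurability _ (RGenOInfty.measurableE R)) => _ [_ [a ->]] <-.
rewrite setTI; apply: open_measurable_borel; exact: open_comp.
Qed.

Lemma closed_sublevel (u : M -> R) (a : R) : continuous u -> closed [set x | u x <= a].
Proof.
move=> cu; rewrite (_ : [set x | _] = u @^-1` [set y | y <= a])//.
by apply: closed_comp => //; exact: closed_le.
Qed.

Lemma closed_superlevel (u : M -> R) (a : R) : continuous u -> closed [set x | a <= u x].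
Proof.
move=> cu; rewrite (_ : [set x | _] = u @^-1` [set y | a <= y])//.
by apply: closed_comp => //; exact: closed_ge.
Qed.

Lemma compact_measurable_borel (A : set M) : compact A -> measurable (A : set (borel M)).
Proof.
move=> cA; have /closed_openC oA : closed A.
  exact: compact_closed (sm_hausdorff X) cA.
rewrite -(setCK (A : set (borel M))); apply: measurableC.
exact: open_measurable_borel.
Qed.

End TestFunctions.

Section Deviation.
Context d (T : measurableType d) (R : realType) (mu : {measure set T -> \bar R}).

(** Convexity of the p-th power at the midpoint, multiplied by 2. *)
Lemma powR_sum_ge (p a b : R) : 1 <= p -> 0 <= a -> 0 <= b ->
  2 `^ (1 - p) * (a + b) `^ p <= a `^ p + b `^ p.
Proof.
move=> p1 a0 b0; have p0 : 0 < p by rewrite (lt_le_trans _ p1).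
have h0 : (0 : R) <= 2^-1 by rewrite invr_ge0.
have h1 : (2^-1 : R) <= 1 by rewrite invf_le1// ler1n.
have h12 : 1 - 2^-1 = 2^-1 :> R by rewrite {1}(splitr 1) div1r addrK.
have : (2^-1 * a + (1 - 2^-1) * b) `^ p <= 2^-1 * a `^ p + (1 - 2^-1) * b `^ p.
  by apply: (convex_powR p1 (Itv01 h0 h1)) => //=; rewrite inE/= in_itv/= ?a0 ?b0.
rewrite h12 -!mulrDr powRM ?addr_ge0// => H.
have -> : 2 `^ (1 - p) = 2 * 2^-1 `^ p :> R.
  rewrite powRD ?pnatr_eq0 ?implybT// powRr1// powRN.
  by rewrite -powR_inv1// powRAC powR_inv1// powR_ge0.
by rewrite -mulrA -ler_pdivlMl//.
Qed.

(** On [A] the deviation is at least a, the positive part of be - c, and on [B] at least b, that of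
    c - al; their sum is at least be - al whatever [c] is. Levels 0 and 1 serve the upper bound,
    general levels the positivity of the Rayleigh denominator. *)
Lemma deviation_ge (p al be c : R) (u : T -> R) (A B : set T) :
  1 < p -> al < be -> measurable A -> measurable B ->
  (forall x, A x -> be <= u x) -> (forall x, B x -> u x <= al) ->
  ((2 `^ (1 - p) * (be - al) `^ p)%:E * Order.min (mu A) (mu B) <=
   \int[mu]_x (`|u x - c| `^ p)%:E)%E.
Proof.
move=> p1 ab mA mB uA uB; have p0 : 0 < p by rewrite (lt_trans _ p1).
pose a := Num.max (be - c) 0; pose b := Num.max (c - al) 0.
have a0 : 0 <= a by rewrite le_max lexx orbT.
have b0 : 0 <= b by rewrite le_max lexx orbT.
have m0 : (0 <= Order.min (mu A) (mu B))%E by rewrite le_min !measure_ge0.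
apply: (@le_trans _ _ ((a `^ p)%:E * mu A + (b `^ p)%:E * mu B)%E).
  apply: (@le_trans _ _ ((a `^ p + b `^ p)%:E * Order.min (mu A) (mu B))%E).
    apply: lee_wpmul2r => //; rewrite lee_fin.
    apply: le_trans (powR_sum_ge (ltW p1) a0 b0).
    rewrite ler_wpM2l ?powR_ge0//; apply: ge0_ler_powR.
    - exact: ltW.
    - by rewrite nnegrE subr_ge0 ltW.
    - by rewrite nnegrE addr_ge0.
    rewrite (_ : be - al = (be - c) + (c - al)); last by ring.
    by rewrite lerD// le_max lexx.
  rewrite EFinD ge0_muleDl ?lee_fin ?powR_ge0//.
  by apply: leeD; apply: lee_wpmul2l; rewrite ?lee_fin ?powR_ge0// ge_min lexx ?orbT.
rewrite -[in X in (X + _ <= _)%E](setIT A) -[in X in (_ + X <= _)%E](setIT B).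
rewrite -!integral_indic// -!ge0_integralZl//; last 4 first.
- by apply/measurable_EFinP; apply: measurable_indic.
- by rewrite lee_fin powR_ge0.
- by apply/measurable_EFinP; apply: measurable_indic.
- by rewrite lee_fin powR_ge0.
rewrite -ge0_integralD//; last 4 first.
- by move=> x _; rewrite -EFinM lee_fin mulr_ge0 ?powR_ge0.
- by apply: measurable_funeM; apply/measurable_EFinP; apply: measurable_indic.
- by move=> x _; rewrite -EFinM lee_fin mulr_ge0 ?powR_ge0.
- by apply: measurable_funeM; apply/measurable_EFinP; apply: measurable_indic.
apply: ge0_le_integralT => x.
  by rewrite -!EFinM -EFinD lee_fin addr_ge0// mulr_ge0 ?powR_ge0.
rewrite -!EFinM -EFinD lee_fin !indicE.
have mono y : 0 <= y -> y <= `|u x - c| -> y `^ p <= `|u x - c| `^ p.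
  by move=> y0 yu; apply: ge0_ler_powR; rewrite ?nnegrE ?(ltW p0).
have [xA|xA] := boolP (x \in A).
  have [xB|xB] := boolP (x \in B).
    move: xA xB; rewrite !inE => /uA ? /uB ?; lra.
  rewrite mulr1 mulr0 addr0; apply: mono => //.
  move: xA; rewrite inE => /uA bu; rewrite ge_max normr_ge0 andbT.
  by apply: le_trans (ler_norm _); rewrite lerD2r.
have [xB|xB] := boolP (x \in B); last by rewrite !mulr0 addr0 powR_ge0.
rewrite mulr0 mulr1 add0r; apply: mono => //.
move: xB; rewrite inE => /uB bu; rewrite ge_max normr_ge0 andbT distrC.
by apply: le_trans (ler_norm _); rewrite lerD2l lerN2.
Qed.

End Deviation.

(** * Comparison of the two constants *)

Section Comparison.
Context {R : realType} {n : nat} {M : ptopologicalType}.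
Variables (X : smooth_manifold R n M) (g : riemannian_metric X).
Hypothesis Mcompact : compact [set: M].
Variable vol : {measure set (borel M) -> \bar R}.
Hypothesis volE : is_riemannian_volume g vol.
Variable p : R.
Hypothesis p1 : 1 < p.

Let p0 : 0 < p. Proof. exact: lt_trans p1. Qed.

Let vol_fin : (vol setT < +oo)%E. Proof. exact: (vol_finite volE). Qed.

Lemma vol_lty (A : set (borel M)) : measurable A -> (vol A < +oo)%E.
Proof.
by move=> mA; apply: le_lt_trans vol_fin; apply: le_measure; rewrite ?inE.
Qed.

Lemma inve_le (x : R) (y : \bar R) : 0 < x -> (x%:E <= y)%E -> (y^-1 <= (x^-1)%:E)%E.
Proof.
move=> x0; case: y => [y| |]//.
  rewrite lee_fin => xy; have y0 := lt_le_trans x0 xy.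
  by rewrite inver gt_eqF// lee_fin lef_pV2.
by move=> _; rewrite invey lee_fin invr_ge0 ltW.
Qed.

Lemma eigenvalue_le_capacity (A B : set M) :
  compact A -> compact B -> (0 < Order.min (vol A) (vol B))%E ->
  (neumann_eigenvalue g vol p <=
   (2 `^ (p - 1))%:E * (capacity g vol p A B / Order.min (vol A) (vol B)))%E.
Proof.
move=> cA cB AB0.
have mA := compact_measurable_borel X cA; have mB := compact_measurable_borel X cB.
have [vA0 vB0] : (0 < vol A)%E /\ (0 < vol B)%E by move: AB0; rewrite lt_min => /andP.
have c0 : 0 < (2 : R) `^ (p - 1) by rewrite powR_gt0.
have ABfin : (Order.min (vol A) (vol B) < +oo)%E by rewrite gt_min vol_lty.
have [m mE m0] : exists2 m : R, Order.min (vol A) (vol B) = m%:E & 0 < m.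
  exists (fine (Order.min (vol A) (vol B))); last by rewrite fine_gt0// AB0 ABfin.
  by rewrite fineK// ge0_fin_numE// ltW.
rewrite mE inver gt_eqF//.
(* Intersecting sets make the right-hand side +oo, and positive volumes exclude empty sets, so only
   the infimum over test functions remains. *)
rewrite /capacity; case: asboolP => [_|disj].
  by rewrite mulyr gtr0_sg ?invr_gt0// mul1e mulry gtr0_sg// mul1e leey.
case: asboolP => [[E|E]|_]; first by move: vA0; rewrite E measure0 ltxx.
  by move: vB0; rewrite E measure0 ltxx.
rewrite -lee_pdivrMl// lee_pdivlMr//; apply: le_ereal_inf_tmp => _ [u [su uA uB] <-].
rewrite -lee_pdivlMr// lee_pdivrMl//.
apply: (@le_trans _ _ (dirichlet_energy g vol p u /
    ereal_inf (range (fun c : R => \int[vol]_x (`|u x - c| `^ p)%:E)))%E).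
  apply: ereal_inf_lbound; exists u; split => // -[c uc].
  have nonempty (D : set M) : (0 < vol D)%E -> exists x, D x.
    by move=> D0; apply/set0P/eqP => E; move: D0; rewrite E measure0 ltxx.
  have [[x Ax] [y By]] := (nonempty A vA0, nonempty B vB0).
  by have := uA x Ax; have := uB y By; rewrite !uc; lra.
rewrite muleCA; apply: lee_wpmul2l; first exact: dirichlet_energy_ge0.
have -> : ((2 `^ (p - 1))%:E * (m^-1)%:E)%E = ((2 `^ (1 - p) * m)^-1)%:E.
  by rewrite -EFinM invfM -powRN opprB.
apply: inve_le; first by rewrite mulr_gt0 ?powR_gt0.
apply: le_ereal_inf_tmp => _ [c _ <-].
have := @deviation_ge _ _ _ vol p 0 1 c u A B p1 ltr01 mA mB uA uB.
by rewrite subr0 powR1 mulr1 mE -EFinM.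
Qed.

Lemma isocapacitary_upper : (neumann_eigenvalue g vol p <=
  (2 `^ (p - 1))%:E * neumann_isocapacitary g vol p)%E.
Proof.
rewrite -lee_pdivrMl ?powR_gt0//; apply: le_ereal_inf_tmp => _ [A [B [cA cB AB0 ->]]].
by rewrite lee_pdivrMl ?powR_gt0//; exact: eigenvalue_le_capacity.
Qed.

(** The test function is an affine rescaling of [u] followed by [Phi], with [sigma] covering both
    sides of [c]. The last hypothesis, supplied by the median, identifies the minimum of the two
    volumes with that of the superlevel set. A real [gamma] below the constant leaves room for an
    infinite one. *)
Lemma level_capacity (gamma sigma c t : R) (u : M -> R) (h Phi : R -> R) :
  (gamma%:E <= neumann_isocapacitary g vol p)%E ->
  smooth_fun X u -> `|sigma| = 1 -> 0 < t ->
  (forall k, class_C k h) -> (forall x : R, is_derive x 1 Phi (h x)) ->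
  (forall x, 0 <= h x) -> (forall x, x <= 0 -> Phi x = 0) ->
  (forall x, 1 <= x -> Phi x = 1) ->
  (vol [set x | t <= sigma * (u x - c)]%R <= vol [set x | sigma * (u x - c) <= 0]%R)%E ->
  (gamma%:E * vol [set x | t <= sigma * (u x - c)]%R <=
   \int[vol]_x ((t^-1 * h (sigma * (u x - c) * t^-1)) `^ p *
     grad_norm g u x `^ p)%:E)%E.
Proof.
move=> gammaG su sigma1 t0 Ch dPhi h0 Phi0 Phi1 half.
have cu := smooth_fun_continuous su.
pose v x := sigma * (u x - c).
have cv : continuous v.
  by move=> x; apply: cvgM; [exact: cvg_cst|apply: cvgB; [exact: cu|exact: cvg_cst]].
set A := [set x | t <= v x]%R; set B := [set x | v x <= 0]%R in half *.
have cA : compact A by apply: (subclosed_compact _ Mcompact) => //; exact: closed_superlevel.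
have cB : compact B by apply: (subclosed_compact _ Mcompact) => //; exact: closed_sublevel.
have rhs0 : (0 <= \int[vol]_x ((t^-1 * h (sigma * (u x - c) * t^-1)) `^ p *
     grad_norm g u x `^ p)%:E)%E.
  by apply: integral_ge0 => x _; rewrite lee_fin mulr_ge0 ?powR_ge0.
(* A null level set is not admissible in the isocapacitary infimum, but then the claim is
   trivial. *)
have [->|vA0] := eqVneq (vol A) 0%E; first by rewrite mule0.
have vA : (0 < vol A)%E by rewrite lt0e vA0 measure_ge0.
have mA := compact_measurable_borel X cA.
have minE : Order.min (vol A) (vol B) = vol A by apply/min_idPl.
have [m mE m0] : exists2 m : R, vol A = m%:E & 0 < m.
  exists (fine (vol A)); last by rewrite fine_gt0// vA vol_lty.
  by rewrite fineK// ge0_fin_numE// vol_lty.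
pose a : R := sigma / t.
have [b bE] : exists b, b = - (a * c) by exists (- (a * c)).
pose psi (s : R) := Phi (a * s + b).
pose dpsi (s : R) := h (a * s + b) * a.
have argE x : a * u x + b = v x * t^-1 by rewrite bE /v /a; ring.
have psiD (y : R) : is_derive y 1 psi (dpsi y).
  apply: (@is_derive1_comp _ Phi (fun y => a * y + b)).
  by apply: is_derive_eq; rewrite addr0 -[LHS]/(a * 1) mulr1.
have Cpsi k : class_C k psi.
  apply: class_C_affine; case: k => [|k]; last by exists h.
  by move=> x; exact: is_derive_continuous (dPhi x).
rewrite mE; apply: (@le_trans _ _ (capacity g vol p A B)).
  rewrite -lee_pdivlMr//; apply: (le_trans gammaG); apply: ereal_inf_lbound.
  exists A, B; split => //; first by rewrite minE.
  by rewrite minE mE inver gt_eqF.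
rewrite /capacity; case: asboolP => [[x [/= Ax Bx]]|_].
  by move: (le_trans Ax Bx); rewrite leNgt t0.
case: asboolP => [_|_]; first exact: rhs0.
apply: (@le_trans _ _ (dirichlet_energy g vol p (psi \o u))).
  apply: ereal_inf_lbound; exists (psi \o u) => //; split.
  - exact: smooth_fun_comp.
  - by move=> x Ax; rewrite /= /psi argE Phi1// ler_pdivlMr// mul1r.
  - by move=> x Bx; rewrite /= /psi argE Phi0// mulr_le0_ge0// invr_ge0 ltW.
rewrite /dirichlet_energy le_eqVlt; apply/orP; left; apply/eqP.
apply: eq_integral => x _; congr EFin.
rewrite (grad_norm_comp g x psiD su) powRM ?normr_ge0 ?grad_norm_ge0//.
rewrite /dpsi argE !normrM sigma1 mul1r normfV (gtr0_norm t0) ger0_norm//.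
by rewrite [h _ * _]mulrC.
Qed.

Lemma compact_bounded_fun (u : M -> R) : continuous u ->
  exists B : R, forall x, `|u x| <= B.
Proof.
move=> cu; have /compact_bounded[B [_ HB]] : compact (u @` setT).
  by apply: continuous_compact => //; exact: continuous_subspaceT.
exists (B + 1) => x; apply: (HB (B + 1)); first by rewrite ltrDl.
by exists x.
Qed.

(** With [c] a median, the p-th power of |u - c| splits into those of the positive parts of u - c
    and c - u. The capacitary inequality bounds each by the energy on its own side of [c]. Finite
    energy gives access to the measurable minorant. *)
Lemma deviation_le_energy (gamma : R) (u : M -> R) : 0 <= gamma ->
  (gamma%:E <= neumann_isocapacitary g vol p)%E -> smooth_fun X u ->
  (dirichlet_energy g vol p u < +oo)%E ->
  exists c, (gamma%:E * \int[vol]_x (`|u x - c| `^ p)%:E <=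
    (2 * p `^ p / (p - 1) `^ (p - 1))%:E * dirichlet_energy g vol p u)%E.
Proof.
move=> gamma0 gammaG su Efin.
have cu := smooth_fun_continuous su; have mu := continuous_measurable_borel cu.
have [B uB] := compact_bounded_fun cu.
have vol_gt0 : (0 < vol setT)%E.
  by apply: (vol_open_gt0 volE openT); exists point.
have [c cP] := median vol_fin mu uB vol_gt0; exists c.
have [h [Phi [Ch dPhi h0 hout [Phi0 Phi1 hp]]]] := smooth_step p1.
set K := 2 * p `^ p / (p - 1) `^ (p - 1) in hp *.
have K0 : 0 <= K by rewrite mulr_ge0 ?invr_ge0 ?mulr_ge0 ?powR_ge0.
have [H [mH HG Hk]] := @measurable_minorant _ _ _ vol (fun x => grad_norm g u x `^ p)
  (fun x => powR_ge0 _ _) Efin.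
have H0 x : 0 <= H x by have /andP[] := HG x.
have sfin : sigma_finite setT vol
  by exists (fun=> setT); [rewrite bigcup_const|move=> _; split].
pose nu : {sigma_finite_measure set (borel M) -> \bar R} := sigma_finite_pack sfin.
pose v (sigma : R) (x : borel M) := sigma * (u x - c).
have mv sigma : measurable_fun setT (v sigma).
  by apply: measurable_funM => //; exact: measurable_funB.
have mvp sigma : measurable_fun setT (fun x => Num.max (v sigma x) 0 `^ p).
  apply: (measurableT_comp (measurable_powR _)); exact: measurable_maxr.
have half sigma : `|sigma| = 1 ->
    (forall t, 0 < t -> (vol [set x | t <= v sigma x]%R <= vol [set x | v sigma x <= 0]%R)%E) ->
    (gamma%:E * \int[vol]_x (Num.max (v sigma x) 0 `^ p)%:E <=
     K%:E * \int[vol]_x (H x * \1_[set x | (0 < v sigma x)%R] x)%:E)%E.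
  move=> sigma1 med.
  apply: (@capacitary_inequality _ _ _ nu p K gamma (v sigma) H h Phi) => //.
    exact: (Ch 0).
  move=> t t0.
  have mk : measurable_fun setT (fun x => (t^-1 * h (v sigma x * t^-1)) `^ p).
    apply: (measurableT_comp (measurable_powR _)); apply: measurable_funM => //.
    apply: (measurableT_comp (continuous_measurable_fun (Ch 0))).
    exact: measurable_funM.
  (* Here the minorant [H] dominates under the integral; the pointwise inequality in the other
     direction returns to the gradient at the end. *)
  apply: le_trans (Hk _ mk (fun x => powR_ge0 _ _)).
  by apply: (level_capacity gammaG su sigma1 t0 Ch dPhi h0 Phi0 Phi1); exact: med.
have P1 : (gamma%:E * \int[vol]_x (Num.max (v 1 x) 0 `^ p)%:E <=
     K%:E * \int[vol]_x (H x * \1_[set x | (0 < v 1 x)%R] x)%:E)%E.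
  apply: half => [|t t0]; first by rewrite normr1.
  have [+ _] := cP t t0; congr (vol _ <= vol _)%E; apply/seteqP; split => x; rewrite /v /=; lra.
have P2 : (gamma%:E * \int[vol]_x (Num.max (v (-1) x) 0 `^ p)%:E <=
     K%:E * \int[vol]_x (H x * \1_[set x | (0 < v (-1) x)%R] x)%:E)%E.
  apply: half => [|t t0]; first by rewrite normrN normr1.
  have [_ +] := cP t t0; congr (vol _ <= vol _)%E; apply/seteqP; split => x; rewrite /v /=; lra.
have splitE x : `|u x - c| `^ p = Num.max (v 1 x) 0 `^ p + Num.max (v (-1) x) 0 `^ p.
  rewrite /v mul1r mulN1r; have [w0|w0] := leP 0 (u x - c).
    by rewrite ger0_norm// [Num.max (- _) _]max_r ?oppr_le0// powR0 ?gt_eqF// addr0.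
  rewrite ltr0_norm// powR0 ?gt_eqF// add0r.
  by rewrite max_l// oppr_ge0 ltW.
have mHi sigma : measurable_fun setT (fun x => H x * \1_[set x | 0 < v sigma x] x).
  by apply: measurable_funM => //; apply: measurable_indic; exact: measurable_gtr.
under eq_integral do rewrite splitE EFinD.
rewrite ge0_integralD//; last 4 first.
- by move=> x _; rewrite lee_fin powR_ge0.
- exact/measurable_EFinP.
- by move=> x _; rewrite lee_fin powR_ge0.
- exact/measurable_EFinP.
rewrite ge0_muleDr; last 2 first.
- by apply: integral_ge0 => x _; rewrite lee_fin powR_ge0.
- by apply: integral_ge0 => x _; rewrite lee_fin powR_ge0.
apply: (le_trans (leeD P1 P2)).
rewrite -ge0_muleDr; last 2 first.
- by apply: integral_ge0 => x _; rewrite lee_fin mulr_ge0.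
- by apply: integral_ge0 => x _; rewrite lee_fin mulr_ge0.
apply: lee_wpmul2l; first by rewrite lee_fin.
rewrite -ge0_integralD//; last 4 first.
- by move=> x _; rewrite lee_fin mulr_ge0.
- exact/measurable_EFinP.
- by move=> x _; rewrite lee_fin mulr_ge0.
- exact/measurable_EFinP.
apply: ge0_le_integralT => x.
  by rewrite -EFinD lee_fin addr_ge0// mulr_ge0.
rewrite -EFinD lee_fin -mulrDr; have /andP[_ HGx] := HG x.
apply: le_trans HGx; rewrite ler_piMr// !indicE.
(* A point lies on at most one side of [c], so the two indicators add up to at most 1. *)
have [|] := boolP (x \in [set x | 0 < v (-1) x]); have [|] := boolP (x \in [set x | 0 < v 1 x]);
  rewrite ?addr0 ?add0r// !inE /v /=; lra.
Qed.

(** Once the denominator [I] is known to be a positive real, the estimate for a suitable [c] passes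
    to the infimum over [c], which is smaller. Letting real [gamma] exhaust the isocapacitary
    constant then covers its finite and infinite values. *)
Lemma isocapacitary_lower : (((p - 1) `^ (p - 1) / (2 * p `^ p))%:E *
  neumann_isocapacitary g vol p <= neumann_eigenvalue g vol p)%E.
Proof.
set C := _ / _; apply: le_ereal_inf_tmp => _ [u [su unc ->]].
have pB0 : 0 < p - 1 by rewrite subr_gt0.
have C0 : 0 < C by rewrite divr_gt0 ?mulr_gt0 ?powR_gt0.
have CE : 2 * p `^ p / (p - 1) `^ (p - 1) = C^-1 by rewrite /C invf_div.
have cu := smooth_fun_continuous su.
set I := ereal_inf _.
have I0 : exists2 i : R, 0 < i & (i%:E <= I)%E.
  have [x [y xy]] : exists x y, u x < u y.
    apply: contrapT => H; apply: unc; exists (u point) => x; apply/eqP; rewrite eq_le !leNgt.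
    by apply/andP; split; apply/negP => h; apply: H; [exists point, x|exists x, point].
  (* The levels cut the gap between two values of [u] into thirds: the strict sublevel and
     superlevel sets are open and nonempty, hence of positive volume, and the deviation bound is
     uniform in [c]. *)
  pose al := u x + (u y - u x) / 3; pose be := u x + (u y - u x) / 3 * 2.
  have [xal alb bey] : [/\ u x < al, al < be & be < u y] by rewrite /al /be; split; lra.
  pose A := [set z | be < u z]; pose B := [set z | u z < al].
  have oA : open A.
    rewrite /A (_ : [set z | _] = u @^-1` [set r | be < r])//.
    by apply: open_comp => //; exact: open_gt.
  have oB : open B.
    rewrite /B (_ : [set z | _] = u @^-1` [set r | r < al])//.
    by apply: open_comp => //; exact: open_lt.
  have vA : (0 < vol A)%E by apply: (vol_open_gt0 volE oA); exists y.
  have vB : (0 < vol B)%E by apply: (vol_open_gt0 volE oB); exists x.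
  have mA := open_measurable_borel oA; have mB := open_measurable_borel oB.
  have m0 : (0 < Order.min (vol A) (vol B))%E by rewrite lt_min vA vB.
  have mfin : (Order.min (vol A) (vol B) < +oo)%E by rewrite gt_min vol_lty.
  exists (2 `^ (1 - p) * (be - al) `^ p * fine (Order.min (vol A) (vol B))).
    by rewrite mulr_gt0 ?mulr_gt0 ?powR_gt0 ?subr_gt0// fine_gt0// m0 mfin.
  rewrite EFinM fineK; last by rewrite ge0_fin_numE// ltW.
  apply: le_ereal_inf_tmp => _ [c _ <-].
  by apply: deviation_ge => // z; rewrite /A /B /=; exact: ltW.
have [B uB] := compact_bounded_fun cu.
have Ifin : (I < +oo)%E.
  apply: (@le_lt_trans _ _ (\int[vol]_x ((`|B| `^ p)%:E * (\1_setT x)%:E))%E).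
    apply: (@le_trans _ _ (\int[vol]_x (`|u x - 0| `^ p)%:E)%E).
      by apply: ereal_inf_lbound; exists 0.
    apply: ge0_le_integralT => x; first by rewrite lee_fin powR_ge0.
    rewrite indicT mule1 lee_fin subr0; apply: ge0_ler_powR; rewrite ?nnegrE ?(ltW p0)//.
    exact: le_trans (uB x) (ler_norm _).
  rewrite ge0_integralZl// ?lee_fin ?powR_ge0//; last exact/measurable_EFinP.
  rewrite integral_indic// setIT lte_mul_pinfty ?lee_fin ?powR_ge0//.
have [i iE i0] : exists2 i : R, I = i%:E & 0 < i.
  case: I0 => i0 i0pos i0I; have I0 : (0 < I)%E by apply: lt_le_trans i0I; rewrite lte_fin.
  by exists (fine I); [rewrite fineK// ge0_fin_numE// ltW|rewrite fine_gt0// I0 Ifin].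
rewrite iE inver gt_eqF//; set E := dirichlet_energy _ _ _ _.
have E0 : (0 <= E)%E by exact: dirichlet_energy_ge0.
have [Ey|Ey] := eqVneq E +oo%E.
  by rewrite Ey mulyr gtr0_sg ?invr_gt0// mul1e leey.
have Efin : (E < +oo)%E by rewrite lt_neqAle Ey leey.
have key (gamma : R) : 0 <= gamma -> (gamma%:E <= neumann_isocapacitary g vol p)%E ->
    (C%:E * gamma%:E <= E * (i^-1)%:E)%E.
  move=> gamma0 gammaG.
  have [c uc] := deviation_le_energy gamma0 gammaG su Efin.
  rewrite lee_pdivlMr// -muleA -lee_pdivlMl// -CE.
  apply: le_trans uc; apply: lee_wpmul2l; first by rewrite lee_fin.
  by rewrite -iE; apply: ereal_inf_lbound; exists c.
have q0 : (0 <= E * (i^-1)%:E)%E by rewrite mule_ge0// lee_fin invr_ge0 ltW.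
case GE : (neumann_isocapacitary g vol p) => [gamma| |].
- have [gamma0|gamma0] := leP 0 gamma; first by apply: key => //; rewrite GE.
  by apply: le_trans q0; rewrite -EFinM lee_fin pmulr_rle0// ltW.
(* Every nonnegative real is now an admissible [gamma]; the choice [C^-1 * A] shows that the
   Rayleigh quotient is at least any positive [A]. *)
- rewrite (_ : (E * (i^-1)%:E)%E = +oo%E) ?leey//; apply/eqyP => A A0.
  have := key (C^-1 * A) _ _; rewrite -EFinM mulrA divff ?gt_eqF// mul1r; apply.
    by rewrite mulr_ge0 ?invr_ge0 ?ltW.
  by rewrite GE leey.
- by apply: le_trans q0; rewrite mulrNy gtr0_sg// mul1e leNye.
Qed.

End Comparison.

Theorem corollary1p4 (R : realType) (n : nat) (M : ptopologicalType)
    (X : smooth_manifold R n M) (g : riemannian_metric X)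
    (Mcompact : compact [set: M]) (Mconnected : connected [set: M])
    (vol : {measure set (borel M) -> \bar R})
    (volE : is_riemannian_volume g vol)
    (p : R) (p_gt1 : 1 < p) :
  (((p - 1) `^ (p - 1) / (2 * p `^ p))%:E * neumann_isocapacitary g vol p
     <= neumann_eigenvalue g vol p)%E /\
  (neumann_eigenvalue g vol p
     <= (2 `^ (p - 1))%:E * neumann_isocapacitary g vol p)%E.
Proof.
split; [exact: isocapacitary_lower|exact: isocapacitary_upper].
Qed.
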